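(* Let $n\ge 1$ and $0<r<R$, and suppose $f_2\colon\mathbb{R}^n\to\mathbb{R}$ and $f_3\colon\mathbb{R}^n\times\mathbb{R}^n\to\mathbb{R}$ are functions such that $f_2$ is continuous and integrable, $\widehat{f_2}(0)=1$, $\widehat{f_2}\ge 0$ everywhere, and $f_3$ is positive definite as a kernel. If $$f_2(x)+f_3(x,0)+f_3(0,x)+f_3(x,x)\le 0 \quad\text{for } r\le|x|\le R,$$ $$f_2(x)\le 0\quad\text{for } |x|\ge R,$$ and $$f_3(x,y)\le 0\quad\text{whenever } r\le|x|\le R,\ r\le |y|\le R\text{ and } |x-y|\ge r,$$ then the sphere packing density in $\mathbb{R}^n$ is at most $$\operatorname{vol}(B_{r/2}^n)\,\bigl(f_2(0)+f_3(0,0)\bigr).$$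
   Context: $|\cdot|$ is the Euclidean norm, and $B^n_{\rho}$ is the closed ball of radius $\rho$ centered at the origin in $\mathbb{R}^n$. The Fourier transform is normalized by $\widehat f(y)=\int_{\mathbb{R}^n} f(x)e^{-2\pi i\langle x,y\rangle}\,dx$. A function $f_3\colon\mathbb{R}^n\times\mathbb{R}^n\to\mathbb{R}$ is positive definite as a kernel if $f_3(x,y)=f_3(y,x)$ for all $x,y$ and $\sum_{x,y\in C}c_xc_yf_3(x,y)\ge 0$ for all finite subsets $C\subseteq\mathbb{R}^n$ and all real weights $(c_x)_{x\in C}$ (no continuity is assumed). The sphere packing density in $\mathbb{R}^n$ is the supremum of the (upper) densities of all packings of congruent balls with disjoint interiors in $\mathbb{R}^n$. *)

(* Defs.v *)
From HB Require Import structures.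
From mathcomp Require Import all_boot all_order all_algebra finmap.
From mathcomp Require Import complex.
From mathcomp Require Import all_classical all_reals all_analysis.

Set Implicit Arguments.
Unset Strict Implicit.
Unset Printing Implicit Defensive.

Import Order.TTheory GRing.Theory Num.Theory.
Import numFieldNormedType.Exports.

Local Open Scope classical_set_scope.
Local Open Scope ring_scope.

(* Product sigma-algebra on R^n, generated by the coordinate maps as the
   library does for [n.-tuple T]; it is the Borel sigma-algebra. *)

Definition rV_display : measure_display.
Proof. exact. Qed.

Section rV_measurable.
Context (R : realType) (n : nat).

Definition rV_coord (i : 'I_n) (v : 'rV[R]_n) : R := v ord0 i.

Let rV_set0 : g_sigma_preimage rV_coord set0.
Proof. exact: sigma_algebra0. Qed.

Let rV_setC A : g_sigma_preimage rV_coord A -> g_sigma_preimage rV_coord (~` A).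
Proof. exact: sigma_algebraC. Qed.

Let rV_bigcup (F : (set 'rV[R]_n)^nat) :
  (forall i, g_sigma_preimage rV_coord (F i)) ->
  g_sigma_preimage rV_coord (\bigcup_i (F i)).
Proof. exact: sigma_algebra_bigcup. Qed.

HB.instance Definition _ := @isMeasurable.Build rV_display 'rV[R]_n
  (g_sigma_preimage rV_coord) rV_set0 rV_setC rV_bigcup.

Lemma measurable_rV_coord (i : 'I_n) : measurable_fun setT (rV_coord i).
Proof.
move=> _ Y mY; rewrite setTI; apply: sub_sigma_algebra => /=.
rewrite -bigcup_seq/=; exists i => /=; first by rewrite mem_index_enum.
by exists Y => //; rewrite setTI.
Qed.

Lemma measurable_fun_rVP d (T : measurableType d) (f : T -> 'rV[R]_n) :
  (forall i, measurable_fun setT (rV_coord i \o f)) -> measurable_fun setT f.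
Proof.
move=> mf _ A mA; rewrite setTI.
have : preimage_set_system setT f (g_sigma_preimage rV_coord) (f @^-1` A).
  by exists A => //; rewrite setTI.
rewrite -g_sigma_preimage_comp; apply: smallest_sub.
  exact: sigma_algebra_measurable.
move=> B; rewrite -bigcup_seq => -[i _ [C mC <-]].
exact: mf.
Qed.

End rV_measurable.

Section cons_rV.
Context (R : realType) (n : nat).

Definition cons_rV (p : measurableTypeR R * 'rV[R]_n) : 'rV[R]_n.+1 :=
  row_mx (p.1 : R)%:M p.2.

Definition uncons_rV (v : 'rV[R]_n.+1) : measurableTypeR R * 'rV[R]_n :=
  (v ord0 ord0, \row_i v ord0 (lift ord0 i)).

Lemma cons_rV0 p : cons_rV p ord0 ord0 = p.1.
Proof.
by rewrite mxE; case: splitP => // j _; rewrite (ord1 j) mxE eqxx mulr1n.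
Qed.

Lemma cons_rVS p i : cons_rV p ord0 (lift ord0 i) = p.2 ord0 i.
Proof.
rewrite mxE; case: splitP => [j|j /= /eqP].
  by rewrite ord1 => /eqP; rewrite eq_sym (negPf (neq_bump _ _)).
by rewrite /bump/= eqn_add2l => /eqP ij; congr (_ _ _); exact: val_inj.
Qed.

Lemma cons_rVK : cancel cons_rV uncons_rV.
Proof.
case=> x v; rewrite /uncons_rV cons_rV0; congr pair.
by apply/rowP => i; rewrite mxE cons_rVS.
Qed.

Lemma uncons_rVK : cancel uncons_rV cons_rV.
Proof.
move=> v; apply/rowP => i; have [j ->|->] := unliftP ord0 i.
  by rewrite cons_rVS mxE.
by rewrite cons_rV0.
Qed.

Lemma measurable_cons_rV : measurable_fun setT cons_rV.
Proof.
apply: measurable_fun_rVP => i; have [j ->|->] := unliftP ord0 i.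
  rewrite (_ : _ \o _ = @rV_coord R n j \o snd); last first.
    by apply/funext => p; exact: cons_rVS.
  by apply: measurableT_comp measurable_snd; exact: measurable_rV_coord.
rewrite (_ : _ \o _ = fst); first exact: measurable_fst.
by apply/funext => p; exact: cons_rV0.
Qed.

Lemma measurable_uncons_rV : measurable_fun setT uncons_rV.
Proof.
apply/measurable_fun_pair; first exact: (@measurable_rV_coord R n.+1 ord0).
apply: measurable_fun_rVP => i.
rewrite (_ : _ \o _ = @rV_coord R n.+1 (lift ord0 i)).
  exact: measurable_rV_coord.
by apply/funext => v; rewrite /rV_coord/= mxE.
Qed.

End cons_rV.

Section lebesgue_cons.
Context (R : realType) (n : nat).
Variable mu : {sigma_finite_measure set 'rV[R]_n -> \bar R}.
Local Open Scope ereal_scope.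

Definition lebesgue_cons : set 'rV[R]_n.+1 -> \bar R :=
  pushforward (lebesgue_measure \x mu) (@cons_rV R n).

Let pm : {measure set 'rV[R]_n.+1 -> \bar R} :=
  measure_function_pushforward__canonical__measure_function_Measure
    (lebesgue_measure \x mu) (@measurable_cons_rV R n).

Let lebesgue_cons0 : lebesgue_cons set0 = 0.
Proof. exact: (measure0 pm). Qed.

Let lebesgue_cons_ge0 A : 0 <= lebesgue_cons A.
Proof. exact: (measure_ge0 pm). Qed.

Let lebesgue_cons_sigma_additive : semi_sigma_additive lebesgue_cons.
Proof. exact: (@measure_semi_sigma_additive _ _ _ pm). Qed.

HB.instance Definition _ := isMeasure.Build _ _ _ lebesgue_cons
  lebesgue_cons0 lebesgue_cons_ge0 lebesgue_cons_sigma_additive.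

Let lebesgue_cons_sigma_finite : sigma_finite setT lebesgue_cons.
Proof.
have /sigma_finiteP[F [TF ndF Foo]] := sigma_finiteT (@lebesgue_measure R).
have /sigma_finiteP[G [TG ndG Goo]] := sigma_finiteT mu.
exists (fun k => @uncons_rV R n @^-1` (F k `*` G k)).
  rewrite -preimage_bigcup (_ : \bigcup_k _ = setT) ?preimage_setT//.
  rewrite -setXTT TF TG predeqE => -[x y]; split.
    by move=> [k _ []/= ? ?]; split; exists k.
  move=> [/= [i _ Fix] [k _ Gky]]; exists (maxn i k) => //; split.
  - by move: x Fix; exact/subsetPset/ndF/leq_maxl.
  - by move: y Gky; exact/subsetPset/ndG/leq_maxr.
move=> k; have [mF Fk] := Foo k; have [mG Gk] := Goo k; split.
  rewrite -[X in measurable X]setTI; apply: measurable_uncons_rV => //.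
  exact: measurableX.
rewrite /lebesgue_cons /pushforward -comp_preimage.
rewrite (_ : _ \o _ = id); last by apply/funext => p; exact: cons_rVK.
by rewrite preimage_id product_measure1E// lte_mul_pinfty// ge0_fin_numE.
Qed.

HB.instance Definition _ := Measure_isSigmaFinite.Build _ _ _ lebesgue_cons
  lebesgue_cons_sigma_finite.

End lebesgue_cons.

Fixpoint lebesgue_rV (R : realType) (n : nat) :
    {sigma_finite_measure set 'rV[R]_n -> \bar R} :=
  match n with
  | 0 => \d_(0 : 'rV[R]_0)
  | m.+1 => lebesgue_cons (lebesgue_rV R m)
  end.

Lemma lebesgue_rV_box (R : realType) (n : nat) (A : 'I_n -> set R) :
  (forall i, measurable (A i)) ->
  lebesgue_rV R n [set v | forall i, A i (v ord0 i)] =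
  (\prod_(i < n) lebesgue_measure (A i))%E.
Proof.
elim: n A => [|n IH] A mA /=.
  by rewrite big_ord0 diracE mem_set// => -[].
pose B : set 'rV[R]_n := [set v | forall i, A (lift ord0 i) (v ord0 i)].
have mB : measurable B.
  rewrite (_ : B = \bigcap_(i in setT) (@rV_coord R n i @^-1` A (lift ord0 i))).
    apply: fin_bigcap_measurable => // i _; rewrite -[X in measurable X]setTI.
    exact: measurable_rV_coord.
  by apply/seteqP; split => v /= vA; move=> i *; exact: vA.
rewrite big_ord_recl -IH => [|//]; rewrite -product_measure1E//;
  last exact: mA.
rewrite /lebesgue_cons /pushforward; congr product_measure1.
apply/seteqP; split=> [p /= pA|p [/= p1 p2] i].
  split => [|i]; first by have := pA ord0; rewrite cons_rV0.
  by have := pA (lift ord0 i); rewrite cons_rVS.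
by have [j ->|->] := unliftP ord0 i; rewrite ?cons_rV0// cons_rVS.
Qed.

Section euclidean.
Context (R : realType) (n : nat).
Implicit Types x y : 'rV[R]_n.

Definition edot x y : R := \sum_(i < n) x ord0 i * y ord0 i.

(* The library norm [`|x|] on row vectors is the sup norm. *)
Definition enorm x : R := Num.sqrt (edot x x).

Definition eball x (rho : R) : set 'rV[R]_n := [set y | enorm (y - x) <= rho].

End euclidean.

Section fourier.
Local Open Scope complex_scope.
Context (R : realType) (n : nat).

Definition Cintegral (g : 'rV[R]_n -> R[i]) : R[i] :=
  (\int[lebesgue_rV R n]_x complex.Re (g x)) +i*
  (\int[lebesgue_rV R n]_x complex.Im (g x)).

Definition expi (t : R) : R[i] := cos t +i* sin t.

Definition fourier (f : 'rV[R]_n -> R) (y : 'rV[R]_n) : R[i] :=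
  Cintegral (fun x => (f x)%:C * expi (- (2 * pi * edot x y))).

End fourier.

Definition pd_kernel (R : realType) (T : choiceType) (f : T -> T -> R) : Prop :=
  (forall x y, f x y = f y x) /\
  (forall (C : {fset T}) (c : T -> R),
    0 <= \sum_(x <- C) \sum_(y <- C) c x * c y * f x y).

Section sphere_packing.
Context (R : realType) (n : nat).
Local Notation vol := (lebesgue_rV R n).

(* The balls of radius [s] centered at the points of [C]. *)
Definition is_packing (C : set 'rV[R]_n) (s : R) : Prop :=
  0 < s /\ trivIset C (fun c => (eball c s)°).

Definition packing_cover (C : set 'rV[R]_n) (s : R) : set 'rV[R]_n :=
  \bigcup_(c in C) eball c s.

Definition upper_density (A : set 'rV[R]_n) : \bar R :=
  limf_esup (fun rho : R => vol (A `&` eball 0 rho) / vol (eball 0 rho))%E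
    (pinfty_nbhs R).

Definition packing_density : \bar R :=
  ereal_sup [set d | exists C s,
    is_packing C s /\ d = upper_density (packing_cover C s)].

End sphere_packing.

(* Main.v *)
(** Write M for f2(0) + f3(0,0), and take a finite set C of N points at mutual
    distances at least r.

    Upper bound.  For y in C, the positivity of f3 on the points x - y with x
    in C at distance at most Rad from y, together with 0, gives that the sum of
    f2(x - y) over x in C is at most M.  Hence the sum of f2(x - y) over all
    pairs is at most N M.

    Lower bound.  A continuous integrable function with nonnegative Fourier
    transform is positive definite (multiply the transform by a Gaussian and
    let its width tend to infinity).  Let p_s be the centred Gaussian of mass
    one whose transform is exp(-|t|^2 / (4 s)).  For small s the transform of
    p_s is at most (1 + eta) times that of f2 (close to 1 near the origin) plus
    eta times that of p_1 (which takes over away from the origin); so the pair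
    sum of p_s is at most (1 + eta) N M plus eta times the pair sum of p_1, and
    the latter is O(N) by separation.  On the other hand p_s = p_2s * p_2s, so
    the pair sum of p_s is the squared L^2 norm of the sum of p_2s(x - .), and
    if C lies in a ball of radius rho, this is at least N^2 (1 - 2 eta) /
    vol(B_(rho + L)) with L independent of rho and C.

    Together N <= (M + e) vol(B_(rho + L)), and the density bound follows by
    scaling the packing radius to r / 2 and letting rho tend to infinity. *)

Require Import Defs.
From HB Require Import structures.
From mathcomp Require Import all_boot all_order all_algebra finmap.
From mathcomp Require Import complex.
From mathcomp Require Import all_classical all_reals all_analysis.
From mathcomp Require Import measurable_realfun ring lra.

Set Implicit Arguments.
Unset Strict Implicit.
Unset Printing Implicit Defensive.

Import Order.TTheory GRing.Theory Num.Theory.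
Import numFieldNormedType.Exports.

Local Open Scope classical_set_scope.
Local Open Scope ring_scope.

(** * Real-valued integrals *)

Section real_integral.
Context d (T : measurableType d) (R : realType) (mu : {measure set T -> \bar R}).
Implicit Types f g h : T -> R.

Definition itg f := mu.-integrable setT (EFin \o f).

Lemma itg_measurable f : itg f -> measurable_fun setT f.
Proof. by move=> /measurable_int/measurable_EFinP. Qed.

Lemma itg_le f g : measurable_fun setT f -> itg g ->
  (forall x, `|f x| <= g x) -> itg f.
Proof.
move=> mf ig fg; apply: (le_integrable _ _ _ ig) => //.
  exact/measurable_EFinP.
by move=> x _ /=; rewrite lee_fin (le_trans (fg x))// ler_norm.
Qed.

Lemma itgD f g : itg f -> itg g -> itg (fun x => f x + g x).
Proof. by move=> ff fg; exact: (integrableD measurableT ff fg). Qed.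

Lemma itgZ (k : R) f : itg f -> itg (fun x => k * f x).
Proof. by move=> ff; exact: (integrableZl measurableT k ff). Qed.

Lemma itgB f g : itg f -> itg g -> itg (fun x => f x - g x).
Proof. by move=> ff fg; exact: (integrableB measurableT ff fg). Qed.

Lemma itg_norm f : itg f -> itg (fun x => `|f x|).
Proof. by move=> ff; exact: (integrable_norm ff). Qed.

Lemma itg_sum I (s : seq I) (F : I -> T -> R) : (forall i, itg (F i)) ->
  itg (fun x => \sum_(i <- s) F i x).
Proof.
move=> iF; rewrite /itg.
rewrite (_ : _ \o _ = fun x => (\sum_(i <- s) (EFin \o F i) x)%E).
  by apply: integrable_sum => // i _; exact: iF.
by apply/funext => x /=; rewrite sumEFin.
Qed.

Lemma EFin_Rintegral f : itg f ->
  (\int[mu]_x f x)%:E = (\int[mu]_x (f x)%:E)%E.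
Proof. by move=> ff; rewrite fineK//; exact: (integrable_fin_num measurableT ff). Qed.

Lemma Rintegral_sum I (s : seq I) (F : I -> T -> R) : (forall i, itg (F i)) ->
  \int[mu]_x (\sum_(i <- s) F i x) = \sum_(i <- s) \int[mu]_x F i x.
Proof.
move=> iF; elim: s => [|i s ih].
  under eq_Rintegral do rewrite big_nil.
  by rewrite Rintegral_cst// mul0r big_nil.
under eq_Rintegral do rewrite big_cons.
by rewrite RintegralD//= ?ih ?big_cons//; [exact: iF|exact: itg_sum].
Qed.

Lemma itg_mul_bounded f h (M : R) : itg f -> measurable_fun setT h ->
  (forall x, `|h x| <= M) -> itg (fun x => f x * h x).
Proof.
move=> iff mh hM; apply: (@itg_le _ (fun x => M * `|f x|)).
- exact/measurable_funM/mh/itg_measurable.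
- exact/itgZ/itg_norm.
- by move=> x; rewrite normrM mulrC ler_wpM2r.
Qed.

End real_integral.

(** * Product measures and Fubini for real-valued integrals *)

Section product_integral.
Context d1 d2 (T1 : measurableType d1) (T2 : measurableType d2) (R : realType).
Context (m1 : {sigma_finite_measure set T1 -> \bar R}).
Context (m2 : {sigma_finite_measure set T2 -> \bar R}).

Lemma itg_prod (f : T1 -> R) (g : T2 -> R) : itg m1 f -> itg m2 g ->
  itg (m1 \x m2)%E (fun z => f z.1 * g z.2).
Proof.
move=> iff ig; have mfg : measurable_fun setT (fun z : T1 * T2 => f z.1 * g z.2).
  apply: measurable_funM.
    exact: measurableT_comp (itg_measurable iff) measurable_fst.
  exact: measurableT_comp (itg_measurable ig) measurable_snd.
apply/integrable12ltyP; first exact/measurable_EFinP.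
under eq_integral.
  move=> x _; under eq_integral do rewrite /= normrM EFinM.
  rewrite integralZl//; last exact: (itg_norm ig).
  rewrite -(EFin_Rintegral (itg_norm ig)) muleC.
over.
rewrite /= integralZl//; last exact: (itg_norm iff).
by rewrite -(EFin_Rintegral (itg_norm iff)) -EFinM ltry.
Qed.

Lemma Rintegral_prod (f : T1 -> R) (g : T2 -> R) : itg m1 f -> itg m2 g ->
  \int[(m1 \x m2)%E]_z (f z.1 * g z.2) = (\int[m1]_x f x) * (\int[m2]_y g y).
Proof.
move=> iff ig; apply: EFin_inj; rewrite (EFin_Rintegral (itg_prod iff ig)).
rewrite -(integral12_prod_meas1 (itg_prod iff ig)) /fubini_F/=.
under eq_integral.
  move=> x _; under eq_integral do rewrite EFinM.
  rewrite integralZl// -(EFin_Rintegral ig) muleC.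
over.
by rewrite /= integralZl// -(EFin_Rintegral iff) -EFinM mulrC.
Qed.

(** Integrability is asked of every section, so that each inner real-valued integral equals the
    extended one appearing in Fubini's theorem. *)
Lemma Rintegral_swap (h : T1 * T2 -> R) : itg (m1 \x m2)%E h ->
  (forall x, itg m2 (fun y => h (x, y))) ->
  (forall y, itg m1 (fun x => h (x, y))) ->
  \int[m1]_x \int[m2]_y h (x, y) = \int[m2]_y \int[m1]_x h (x, y).
Proof.
move=> ih i1 i2; congr fine.
under eq_integral do rewrite (EFin_Rintegral (i1 _)).
under [RHS]eq_integral do rewrite (EFin_Rintegral (i2 _)).
exact: (Fubini ih).
Qed.

End product_integral.

(** * Measurability of Euclidean functions on row vectors *)

Section rV_functions.
Context (R : realType) (n : nat).
Implicit Types (x y : 'rV[R]_n).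

Lemma measurable_edotl y : measurable_fun setT (fun x => edot x y).
Proof.
apply: (@measurable_sum _ _ _ _ _ _ (fun i (x : 'rV[R]_n) => x ord0 i * y ord0 i)).
by move=> i; apply: measurable_funM => //; exact: measurable_rV_coord.
Qed.

Lemma measurable_rV_trans y : measurable_fun setT (fun x => x - y).
Proof.
apply: measurable_fun_rVP => i.
rewrite (_ : _ \o _ = fun x => rV_coord i x - y ord0 i); last first.
  by apply/funext => x; rewrite /rV_coord/= !mxE.
by apply: measurable_funB => //; exact: measurable_rV_coord.
Qed.

Lemma measurable_edot_diag : measurable_fun setT (fun x => edot x x).
Proof.
apply: (@measurable_sum _ _ _ _ _ _ (fun i (x : 'rV[R]_n) => x ord0 i * x ord0 i)).
by move=> i; apply: measurable_funM => //; exact: measurable_rV_coord.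
Qed.

Lemma measurable_enorm : measurable_fun setT (@enorm R n).
Proof.
exact: measurableT_comp (continuous_measurable_fun (@sqrt_continuous R))
  measurable_edot_diag.
Qed.

Lemma measurable_eball c rho : measurable (@eball R n c rho).
Proof.
rewrite -[eball _ _]setTI.
apply: (measurable_fun_le (f := fun x => enorm (x - c)) (g := cst rho)) => //.
exact: measurableT_comp measurable_enorm (measurable_rV_trans _).
Qed.

End rV_functions.

(** * Integration over one more coordinate *)

Section integral_cons_rV.
Context (R : realType) (n : nat).
Notation vol := (lebesgue_rV R n).
Notation volS := (lebesgue_rV R n.+1).
Notation leb := (@lebesgue_measure R).

(** [volS] unfolds to this pushforward, so integrals over it become integrals over the product
    measure. *)
Let push : {measure set 'rV[R]_n.+1 -> \bar R} :=
  measure_function_pushforward__canonical__measure_function_Measure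
    (leb \x vol)%E (@measurable_cons_rV R n).

Lemma itg_cons_rV (h : 'rV[R]_n.+1 -> R) : measurable_fun setT h ->
  itg (leb \x vol)%E (h \o @cons_rV R n) -> itg volS h.
Proof.
move=> mh ih; have ip : push.-integrable setT (EFin \o h).
  have mE : measurable_fun setT (EFin \o h) by exact/measurable_EFinP.
  exact: (@integrable_pushforward _ _ _ _ _ _ (@measurable_cons_rV R n) _ setT _ mE ih measurableT).
exact: ip.
Qed.

Lemma Rintegral_cons_rV (h : 'rV[R]_n.+1 -> R) : measurable_fun setT h ->
  itg (leb \x vol)%E (h \o @cons_rV R n) ->
  \int[volS]_v h v = \int[(leb \x vol)%E]_z h (cons_rV z).
Proof.
move=> mh ih; congr fine; rewrite (eq_measure_integral push)//.
rewrite (@integral_pushforward _ _ _ _ _ _ (@measurable_cons_rV R n))//.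
exact/measurable_EFinP.
Qed.

(** This serves as the induction step on the dimension for Gaussians, which split into a factor in
    the first coordinate and a factor in the others. *)
Lemma Rintegral_cons_prod (f : R -> R) (g : 'rV[R]_n -> R) (h : 'rV[R]_n.+1 -> R) :
  measurable_fun setT h -> itg leb f -> itg vol g ->
  (forall z, h (cons_rV z) = f z.1 * g z.2) ->
  itg volS h /\ \int[volS]_v h v = (\int[leb]_x f x) * (\int[vol]_v g v).
Proof.
move=> mh iff ig hE; have hcE : h \o @cons_rV R n = fun z => f z.1 * g z.2.
  by apply/funext => z; exact: hE.
have ihc : itg (leb \x vol)%E (h \o @cons_rV R n) by rewrite hcE; exact: itg_prod.
split; first exact: itg_cons_rV.
by rewrite Rintegral_cons_rV// -Rintegral_prod//; apply: eq_Rintegral => z _.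
Qed.

End integral_cons_rV.

(** * Affine changes of variables *)

Section affine_change.
Context (R : realType).
Local Open Scope ereal_scope.

Let measurable_affine (c k : R) :
  @measurable_fun _ _ (measurableTypeR R) (measurableTypeR R) setT
    (fun x : R => c + k * x)%R.
Proof. by apply: measurable_funD => //; exact: measurable_funM. Qed.

(** As functions of [A], both sides are measures that agree on half-open intervals, and Lebesgue
    measure is determined by its values there. *)
Lemma lebesgue_measure_affine (c k : R) (A : set R) : (0 < k)%R -> measurable A ->
  k%:E * lebesgue_measure [set x | A (c + k * x)%R] = lebesgue_measure A.
Proof.
move=> k0 mA; pose kn := NngNum (ltW k0).
pose push : {measure set (measurableTypeR R) -> \bar R} :=
  measure_function_pushforward__canonical__measure_function_Measure
    lebesgue_measure (measurable_affine c k).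
pose kpush : {measure set (measurableTypeR R) -> \bar R} := mscale kn push.
apply/esym; apply: (@lebesgue_measure_unique R kpush) mA => _ [[a b] _ <-].
rewrite /kpush/= /mscale /= /pushforward /=.
rewrite (_ : _ @^-1` _ = `](a - c) / k, (b - c) / k]%classic)%R; last first.
  apply/seteqP; split => x /=; rewrite !in_itv/= ltr_pdivrMr// ler_pdivlMr//.
    by rewrite ltrBlDl lerBrDl (mulrC x).
  by rewrite ltrBlDl lerBrDl (mulrC x).
rewrite !lebesgue_measure_itv/= !lte_fin ltr_pM2r ?invr_gt0// ltrD2r.
case: ifPn => ab; last by rewrite mule0.
rewrite -!EFinD -EFinM; congr EFin; field; exact: lt0r_neq0.
Qed.

Lemma ge0_integral_affine (c k : R) (f : R -> \bar R) : (0 < k)%R ->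
  measurable_fun setT f -> (forall x, 0 <= f x) ->
  k%:E * \int[lebesgue_measure]_x f (c + k * x)%R = \int[lebesgue_measure]_x f x.
Proof.
move=> k0 mf f0; pose kn := NngNum (ltW k0).
pose push : {measure set (measurableTypeR R) -> \bar R} :=
  measure_function_pushforward__canonical__measure_function_Measure
    lebesgue_measure (measurable_affine c k).
pose kpush : {measure set (measurableTypeR R) -> \bar R} := mscale kn push.
rewrite -[RHS](@eq_measure_integral _ _ _ _ _ kpush).
  rewrite ge0_integral_mscale//; congr (_ * _).
  by rewrite (@ge0_integral_pushforward _ _ _ _ _ _ (measurable_affine c k)).
by move=> A mA _; exact: lebesgue_measure_affine.
Qed.

Lemma measurable_rV_affine n (c : 'rV[R]_n) (k : R) :
  measurable_fun setT (fun v : 'rV[R]_n => c + k *: v)%R.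
Proof.
apply: measurable_fun_rVP => i.
rewrite (_ : _ \o _ = fun x => c ord0 i + k * rV_coord i x)%R; last first.
  by apply/funext => x; rewrite /rV_coord/= !mxE.
apply: measurable_funD => //; apply: measurable_funM => //.
exact: measurable_rV_coord.
Qed.

(** Induction on the dimension: after slicing along the first coordinate, the sections transform by
    the induction hypothesis and the outer integral by the one-dimensional rule, each coordinate
    giving one factor [k]. *)
Lemma lebesgue_rV_affine n (c : 'rV[R]_n) (k : R) (A : set 'rV[R]_n) :
  (0 < k)%R -> measurable A ->
  (k ^+ n)%:E * lebesgue_rV R n [set v | A (c + k *: v)%R] = lebesgue_rV R n A.
Proof.
move=> k0; elim: n c A => [|n ih] c A mA.
  rewrite expr0 mul1e; congr (lebesgue_rV R 0 _); apply/seteqP; split => v/=;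
  by rewrite (_ : (c + k *: v = v)%R)//; apply/rowP => -[].
rewrite /= /lebesgue_cons /pushforward /= /product_measure1 /=.
have mB : measurable (@cons_rV R n @^-1` A).
  by rewrite -[X in measurable X]setTI; exact: measurable_cons_rV.
pose c0 := c ord0 ord0; pose c' := (uncons_rV c).2.
pose phi x := lebesgue_rV R n (xsection (@cons_rV R n @^-1` A) x).
rewrite exprS EFinM.
have mphi : measurable_fun setT phi by exact: measurable_fun_xsection.
rewrite -(ge0_integral_affine c0 k0 mphi)//.
have mC : measurable (@cons_rV R n @^-1` [set v | A (c + k *: v)%R]).
  rewrite -[X in measurable X]setTI; apply: measurable_cons_rV => //.
  by rewrite -[X in measurable X]setTI; exact: measurable_rV_affine.
rewrite -muleA; congr (_ * _); rewrite -ge0_integralZl//; last 2 first.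
- exact: (measurable_fun_xsection _ mC).
- by rewrite lee_fin exprn_ge0// ltW.
apply: eq_integral => x _; rewrite /phi -[RHS](ih c'); last exact: measurable_xsection.
congr (_ * lebesgue_rV R n _); apply/seteqP; split => v /=;
  rewrite !/xsection /= !inE /=;
  rewrite (_ : (c + k *: cons_rV (x, v) = cons_rV (c0 + k * x, c' + k *: v))%R)//;
  (apply/rowP => i; have [j ->|->] := unliftP ord0 i;
    by rewrite [LHS]mxE [X in (_ + X)%R]mxE ?cons_rVS ?cons_rV0//= !mxE).
Qed.

End affine_change.

Lemma Rintegral_lin d (T : measurableType d) (R : realType)
    (mu : {measure set T -> \bar R}) (a b : R) (f g : T -> R) :
  itg mu f -> itg mu g -> \int[mu]_x (a * f x + b * g x) =
  a * (\int[mu]_x f x) + b * (\int[mu]_x g x).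
Proof.
by move=> iff ig; rewrite RintegralD ?RintegralZl//; [exact: itgZ|exact: itgZ].
Qed.

(** * Measure-preserving maps and translation invariance *)

Section measure_preserving.
Context d (T : measurableType d) (R : realType) (mu : {measure set T -> \bar R}).
Context (phi : T -> T) (mphi : measurable_fun setT phi).
Hypothesis phi_mu : forall A, measurable A -> mu (phi @^-1` A) = mu A.

Let push : {measure set T -> \bar R} :=
  measure_function_pushforward__canonical__measure_function_Measure mu mphi.

Let pushE A : measurable A -> A `<=` setT -> push A = mu A.
Proof. by move=> mA _; exact: phi_mu. Qed.

Lemma itg_preserving (f : T -> R) : itg mu f -> itg mu (f \o phi).
Proof.
move=> iff; have mf := itg_measurable iff.
apply/integrableP; split; first exact/measurable_EFinP/measurableT_comp.
have /integrableP[_] := iff; rewrite -(eq_measure_integral mu pushE).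
rewrite (@ge0_integral_pushforward _ _ _ _ _ _ mphi)//.
by apply: measurableT_comp => //; exact/measurable_EFinP.
Qed.

Lemma Rintegral_preserving (f : T -> R) : itg mu f ->
  \int[mu]_x f (phi x) = \int[mu]_x f x.
Proof.
move=> iff; congr fine; rewrite -[RHS](eq_measure_integral mu pushE).
rewrite (@integral_pushforward _ _ _ _ _ _ mphi)//.
  exact/measurable_EFinP/(itg_measurable iff).
exact: itg_preserving.
Qed.

End measure_preserving.

Section translation.
Context (R : realType) (n : nat).
Notation vol := (lebesgue_rV R n).
Implicit Types (f : 'rV[R]_n -> R) (c : 'rV[R]_n).

Let measurable_addl c : measurable_fun setT (fun x => c + x).
Proof.
have := measurable_rV_affine c 1; congr (measurable_fun _ _).
by apply/funext => x; rewrite scale1r.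
Qed.

Lemma lebesgue_rV_translate c A : measurable A ->
  vol ((fun x => c + x) @^-1` A) = vol A.
Proof.
move=> mA; rewrite -(lebesgue_rV_affine c ltr01 mA) expr1n mul1e.
by congr (vol _); apply/seteqP; split => x /=; rewrite scale1r.
Qed.

Lemma itg_translate f c : itg vol f -> itg vol (fun x => f (c + x)).
Proof. exact: (itg_preserving (measurable_addl c) (lebesgue_rV_translate c)). Qed.

Lemma Rintegral_translate f c : itg vol f ->
  \int[vol]_x f (c + x) = \int[vol]_x f x.
Proof.
exact: (Rintegral_preserving (measurable_addl c) (lebesgue_rV_translate c)).
Qed.

End translation.

Section translation1.
Context (R : realType).
Notation leb := (@lebesgue_measure R).
Implicit Types (f : R -> R) (c : R).

Let measurable_addl c : @measurable_fun _ _ (measurableTypeR R)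
  (measurableTypeR R) setT (fun x : R => c + x).
Proof. exact: measurable_funD. Qed.

Let lebesgue_measure_translate c (A : set (measurableTypeR R)) : measurable A ->
  leb ((fun x => c + x) @^-1` A) = leb A.
Proof.
move=> mA; rewrite -(lebesgue_measure_affine c ltr01 mA) mul1e.
by congr (leb _); apply/seteqP; split => x /=; rewrite mul1r.
Qed.

Lemma itg_translate1 f c : itg leb f -> itg leb (fun x => f (c + x)).
Proof.
exact: (itg_preserving (measurable_addl c) (@lebesgue_measure_translate c)).
Qed.

Lemma Rintegral_translate1 f c : itg leb f ->
  \int[leb]_x f (c + x) = \int[leb]_x f x.
Proof.
exact: (Rintegral_preserving (measurable_addl c) (@lebesgue_measure_translate c)).
Qed.

End translation1.

(** * The one-dimensional Gaussian and its cosine transform *)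

Section gaussian1.
Context (R : realType).
Notation leb := (@lebesgue_measure R).
Implicit Types (a x t : R).

Definition gauss1 a x : R := expR (- (a * x ^+ 2)).

Lemma gauss1_ge0 a x : 0 <= gauss1 a x. Proof. exact: expR_ge0. Qed.

Lemma measurable_gauss1 a : measurable_fun setT (gauss1 a).
Proof.
apply: measurableT_comp => //; apply: measurableT_comp => //.
by apply: measurable_funM => //; exact: measurable_funX.
Qed.

(** The normal density of variance [1 / (2 a)] has known integrability and total mass, which this
    identity transfers to [gauss1 a]. *)
Lemma gauss1E a x : 0 < a ->
  gauss1 a x = Num.sqrt (pi / a) * normal_pdf 0 (Num.sqrt (a *+ 2)^-1) x.
Proof.
move=> a0; have s0 : Num.sqrt (a *+ 2)^-1 != 0 :> R.
  by rewrite sqrtr_eq0 -ltNge invr_gt0 pmulrn_lgt0.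
rewrite normal_pdfE// /normal_peak /normal_fun sqr_sqrtr; last first.
  by rewrite invr_ge0 mulrn_wge0// ltW.
have -> : (a *+ 2)^-1 * pi *+ 2 = pi / a by rewrite -mulr_natr; field; exact: lt0r_neq0.
rewrite mulrA divff ?mul1r; last first.
  by rewrite sqrtr_eq0 -ltNge divr_gt0// pi_gt0.
by congr expR; rewrite subr0; field; exact: lt0r_neq0.
Qed.

Lemma itg_gauss1 a : 0 < a -> itg leb (gauss1 a).
Proof.
move=> a0; rewrite (_ : gauss1 a = fun x =>
  Num.sqrt (pi / a) * normal_pdf 0 (Num.sqrt (a *+ 2)^-1) x); last first.
  by apply/funext => x; exact: gauss1E.
apply: itgZ; exact: integrable_normal_pdf.
Qed.

Lemma Rintegral_gauss1 a : 0 < a -> \int[leb]_x gauss1 a x = Num.sqrt (pi / a).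
Proof.
move=> a0; under eq_Rintegral do rewrite gauss1E//.
rewrite RintegralZl//; last exact: integrable_normal_pdf.
by rewrite /Rintegral integral_normal_pdf mulr1.
Qed.

(* The integral of [F (h + x)] does not depend on [h]: differentiate at [h = 0]. *)
Lemma Rintegral_derive_gauss (F : R -> R) (F' : R -> R) (K b : R) : 0 < b -> 0 <= K ->
  itg leb F -> (forall x, is_derive x 1 F (F' x)) ->
  (forall x, `|F' x| <= K * gauss1 b x) -> \int[leb]_x F' x = 0.
Proof.
move=> b0 K0 iF dF F'K.
pose f h x := F (h + x).
have itf h : itg leb (f h) by exact: itg_translate1.
have dfE (h x : R) : is_derive h (1 : R) (f ^~ x) (F' (h + x)).
  have dh : is_derive h (1 : R) (fun h : R => h + x) 1.
    by have := is_deriveD (is_derive_id h (1:R)) (is_derive_cst x h 1); rewrite addr0.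
  by have := @is_derive1_comp _ F (fun h => h + x) h _ _ (dF (h + x)) dh; rewrite mulr1.
have ddf (h x : R) : derivable (f ^~ x) h 1 by have [] := dfE h x.
have I0 : `](-1), 1[%classic (0 : R) by rewrite /= in_itv/= ltrN10 ltr01.
(* Completing the square gives [b (h + x)^2 >= b x^2 / 2 - b] for [|h| < 1], so [G] dominates all
   the derivatives [F' (h + x)] at once. *)
pose G y := K * expR b * gauss1 (b / 2) y.
have dE h x : partial1of2 f h x = F' (h + x).
  by rewrite /partial1of2 derive1E; have [] := dfE h x.
have G_ub (h x : R) : `](-1), 1[%classic h -> setT x -> `|partial1of2 f h x| <= G x.
  rewrite /= in_itv/= => /andP[h1 h2] _; rewrite dE (le_trans (F'K _))//.
  rewrite /G -mulrA ler_wpM2l// /gauss1 -expRD ler_expR.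
  rewrite -subr_ge0 (_ : _ - _ = b * (1 - h ^+ 2) + b / 2 * (x + h *+ 2) ^+ 2); last by field.
  by apply: addr_ge0; apply: mulr_ge0; rewrite ?sqr_ge0 ?divr_ge0 ?ltW//; nra.
have G0 y : 0 <= G y by rewrite !mulr_ge0 ?expR_ge0.
have iG : itg leb G by apply: itgZ; apply: itg_gauss1; rewrite divr_gt0.
have := @differentiation_under_integral _ _ _ leb f setT measurableT 0 (-1) 1 I0
  (fun h _ => itf h) (fun h x _ _ => ddf h x) G G0 iG G_ub.
under eq_Rintegral do rewrite dE add0r.
move=> <-; rewrite (_ : (fun h => _) = cst (\int[leb]_x F x)).
  by rewrite derive1_cst.
by apply/funext => h; exact: Rintegral_translate1.
Qed.

(** Differentiation under the integral and integration by parts show that the integral, as a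
    function [c] of [t], solves [2 a c' = - t c]. Hence [c t * expR (t^2 / (4 a))] is constant, and
    its value at 0 is the Gaussian mass. *)
Lemma Rintegral_gauss1_cos a t : 0 < a ->
  \int[leb]_x (gauss1 a x * cos (t * x)) =
  Num.sqrt (pi / a) * expR (- (t ^+ 2 / (a *+ 4))).
Proof.
move=> a0; pose f (t x : R) := gauss1 a x * cos (t * x).
pose f' (t x : R) := - (gauss1 a x * x * sin (t * x)).
have mtx s : measurable_fun setT (fun x : R => s * x) by exact: measurable_funM.
have mcos s : measurable_fun setT (fun x : R => cos (s * x)).
  exact: measurableT_comp (continuous_measurable_fun (@continuous_cos R)) (mtx s).
have msin s : measurable_fun setT (fun x : R => sin (s * x)).
  exact: measurableT_comp (continuous_measurable_fun (@continuous_sin R)) (mtx s).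
have itf s : itg leb (f s).
  apply: (itg_mul_bounded (M := 1) (itg_gauss1 a0) (mcos s)) => x.
  by rewrite ler_norml cos_geN1 cos_le1.
(* Half of the exponent absorbs the factor [x] of the derivative: [|x| <= 1 + x^2 <= (1 + 2 / a) *
   expR (a x^2 / 2)]. *)
pose G x := (1 + 2 / a) * gauss1 (a / 2) x.
have a2 : 0 < a / 2 by rewrite divr_gt0.
have K0 : 0 <= 1 + 2 / a by rewrite addr_ge0// divr_ge0// ltW.
have iG : itg leb G by apply: itgZ; exact: itg_gauss1.
have G0 y : 0 <= G y by rewrite mulr_ge0 ?expR_ge0.
have xG x : `|x| * gauss1 a x <= G x.
  rewrite /G /gauss1 (_ : - (a * x ^+ 2) = - (a / 2 * x ^+ 2) - a / 2 * x ^+ 2); last by field.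
  rewrite expRD mulrCA mulrC ler_wpM2r ?expR_ge0//.
  rewrite expRN ler_pdivrMr ?expR_gt0//.
  apply: (@le_trans _ _ ((1 + 2 / a) * (1 + a / 2 * x ^+ 2))); last first.
    by rewrite ler_wpM2l// expR_ge1Dx.
  rewrite [X in _ <= X](_ : _ = 1 + x ^+ 2 + (2 / a + a / 2 * x ^+ 2)); last first.
    by field; exact: lt0r_neq0.
  apply: ler_wpDr; first by apply: addr_ge0; [rewrite divr_ge0 ?ltW|rewrite mulr_ge0 ?sqr_ge0 ?ltW].
  by rewrite -real_normK ?num_real//; nra.
have dtx (s x : R) : is_derive s (1 : R) (fun s => s * x) x.
  have := is_deriveM (is_derive_id s (1 : R)) (is_derive_cst x s 1).
  by rewrite scaler0 add0r /GRing.scale/= mulr1.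
have df (s x : R) : is_derive s (1 : R) (f ^~ x) (f' s x).
  have := @is_derive1_comp _ cos (fun s => s * x) s _ _ (is_derive_cos _) (dtx s x).
  move/(is_deriveZ (gauss1 a x)); congr (is_derive _ _ _ _).
  by rewrite /f' /GRing.scale/=; ring.
have ddf (h x : R) : derivable (f ^~ x) h 1 by have [] := df h x.
have f'G s x : `|f' s x| <= G x.
  rewrite /f' normrN normrM; apply: le_trans (xG x).
  rewrite normrM (ger0_norm (gauss1_ge0 _ _)) (mulrC (gauss1 a x)).
  by rewrite ler_piMr ?mulr_ge0 ?gauss1_ge0// ler_norml sin_geN1 sin_le1.
have itf' s : itg leb (f' s).
  apply: itg_le iG (f'G s); apply: measurableT_comp => //.
  apply: measurable_funM (msin s).
  by apply: measurable_funM => //; exact: measurable_gauss1.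
pose c s := \int[leb]_x f s x.
have dc (s : R) : is_derive s (1 : R) c (\int[leb]_x f' s x).
  have Is : `](s - 1), (s + 1)[%classic (s : R) by rewrite /= in_itv/=; apply/andP; split; lra.
  have dE (h x : R) : partial1of2 f h x = f' h x.
    by rewrite /partial1of2 derive1E; have [] := df h x.
  have G_ub (h x : R) : `](s - 1), (s + 1)[%classic h -> setT x -> `|partial1of2 f h x| <= G x.
    by move=> _ _; rewrite dE f'G.
  apply: DeriveDef.
    exact: (derivable_under_integral measurableT Is (fun h _ => itf h)
      (fun h x _ _ => ddf h x) G0 iG G_ub).
  rewrite -derive1E (differentiation_under_integral measurableT Is (fun h _ => itf h)
      (fun h x _ _ => ddf h x) G0 iG G_ub).
  by apply: eq_Rintegral => x _; rewrite dE.
(* Integrate the derivative of [gauss1 a x * sin (s * x)]. *)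
have ibp s : s * c s + (a *+ 2) * (\int[leb]_x f' s x) = 0.
  rewrite /c -(Rintegral_lin s (a *+ 2) (itf s) (itf' s)).
  have dF (x : R) : is_derive x (1 : R) (fun x => gauss1 a x * sin (s * x))
      (s * f s x + a *+ 2 * f' s x).
    have dsx : is_derive x (1 : R) (fun x => s * x) s.
      have := is_deriveZ s (is_derive_id x (1 : R)).
      by rewrite /GRing.scale/= mulr1.
    have d1 := @is_derive1_comp _ sin (fun x => s * x) x _ _ (is_derive_sin _) dsx.
    have d2 : is_derive x (1 : R) (fun x : R => - (a * x ^+ 2)) (- (a * (x *+ 2))).
      have := is_deriveN (is_deriveZ a (is_deriveX 2 (is_derive_id x (1 : R)))).
      by congr (is_derive _ _ _ _); rewrite /GRing.scale/=; ring.
    have d3 := @is_derive1_comp _ expR _ x _ _ (is_derive_expR _) d2.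
    have := is_deriveM d3 d1; congr (is_derive _ _ _ _).
    by rewrite /f /f' /gauss1 /GRing.scale/=; ring.
  apply: (@Rintegral_derive_gauss _ _ (`|s| + a *+ 2 * (1 + 2 / a)) _ a2 _ _ dF).
  - by rewrite addr_ge0// mulr_ge0// mulrn_wge0// ltW.
  - apply: (itg_mul_bounded (M := 1) (itg_gauss1 a0) (msin s)) => x.
    by rewrite ler_norml sin_geN1 sin_le1.
  - move=> x; rewrite [leRHS]mulrDl; apply: le_trans (ler_normD _ _) _; apply: lerD.
      rewrite normrM ler_wpM2l// /f normrM (ger0_norm (gauss1_ge0 _ _)).
      apply: (@le_trans _ _ (gauss1 a x)).
        by rewrite ler_piMr ?gauss1_ge0// ler_norml cos_geN1 cos_le1.
      by rewrite ler_expR lerN2 ler_wpM2r ?sqr_ge0//; lra.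
    rewrite normrM -mulrA ger0_norm; last by rewrite mulrn_wge0// ltW.
    by rewrite ler_wpM2l ?mulrn_wge0 ?(ltW a0)// f'G.
pose e (s : R) := expR (s ^+ 2 / (a *+ 4)).
have dh (s : R) : is_derive s (1 : R) (fun s => c s * e s) 0.
  have d2 : is_derive s (1 : R) (fun s : R => s ^+ 2 / (a *+ 4)) (s *+ 2 / (a *+ 4)).
    have := is_deriveM (is_deriveX 2 (is_derive_id s (1 : R))) (is_derive_cst (a *+ 4)^-1 s 1).
    by congr (is_derive _ _ _ _); rewrite /GRing.scale/=; field; exact: lt0r_neq0.
  have d3 := @is_derive1_comp _ expR _ s _ _ (is_derive_expR _) d2.
  have := is_deriveM (dc s) d3; congr (is_derive _ _ _ _).
  have -> : \int[leb]_x f' s x = - (s * c s) / (a *+ 2).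
    apply: (mulfI (x := a *+ 2)); first by rewrite gt_eqF// pmulrn_lgt0.
    rewrite mulrCA divff ?mulr1; last by rewrite gt_eqF// pmulrn_lgt0.
    by apply/eqP; rewrite -addr_eq0 addrC ibp.
  by rewrite /GRing.scale/=; field; exact: lt0r_neq0.
have := @is_derive_0_is_cst _ (fun s => c s * e s) t 0 dh.
rewrite {2}/e expr0n mul0r expR0 mulr1 {2}/c/f.
under eq_Rintegral do rewrite mul0r cos0 mulr1.
rewrite Rintegral_gauss1// => <-.
by rewrite -mulrA -expRD addrN expR0 mulr1.
Qed.

End gaussian1.

(** * Gaussians and their cosine transforms *)

Section reflection1.
Context (R : realType).
Notation leb := (@lebesgue_measure R).

Let measurable_opp : @measurable_fun _ _ (measurableTypeR R) (measurableTypeR R)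
  setT (fun x : R => - x).
Proof. exact: measurable_funN. Qed.

Let lebesgue_measureN (A : set (measurableTypeR R)) : measurable A ->
  leb ((fun x => - x) @^-1` A) = leb A.
Proof.
move=> mA; pose push : {measure set (measurableTypeR R) -> \bar R} :=
  measure_function_pushforward__canonical__measure_function_Measure leb measurable_opp.
apply/esym; apply: (@lebesgue_measure_unique R push) mA => _ [[a b] _ <-].
rewrite /push/= /pushforward /= (_ : _ @^-1` _ = `[- b, - a[%classic); last first.
  by apply/seteqP; split => x /=; rewrite !in_itv/= lerNl ltrNr andbC.
by rewrite !lebesgue_measure_itv/= !lte_fin ltrN2; case: ifPn => // _; rewrite -!EFinD opprK addrC.
Qed.

Lemma Rintegral_odd (f : R -> R) : itg leb f -> (forall x, f (- x) = - f x) ->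
  \int[leb]_x f x = 0.
Proof.
move=> iff fN; have := Rintegral_preserving measurable_opp lebesgue_measureN iff.
under eq_Rintegral do rewrite fN -mulN1r.
by rewrite RintegralZl//; lra.
Qed.

End reflection1.

Section gaussian.
Context (R : realType).
Notation leb := (@lebesgue_measure R).

Definition gauss n (a : R) (x : 'rV[R]_n) : R := expR (- (a * edot x x)).

Lemma edot_recl n (x y : 'rV[R]_n.+1) : edot x y =
  x ord0 ord0 * y ord0 ord0 + edot (uncons_rV x).2 (uncons_rV y).2.
Proof.
by rewrite /edot big_ord_recl; congr (_ + _); apply: eq_bigr => i _; rewrite !mxE.
Qed.

Lemma edot_ge0 n (x : 'rV[R]_n) : 0 <= edot x x.
Proof. by apply: sumr_ge0 => i _; rewrite -expr2 sqr_ge0. Qed.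

Lemma gauss_ge0 n a (x : 'rV[R]_n) : 0 <= gauss a x.
Proof. exact: expR_ge0. Qed.

Lemma measurable_gauss n a : measurable_fun setT (@gauss n a).
Proof.
apply: measurableT_comp => //; apply: measurableT_comp => //.
by apply: measurable_funM => //; exact: measurable_edot_diag.
Qed.

Lemma measurable_cos_edot n (t : 'rV[R]_n) : measurable_fun setT (fun x => cos (edot x t)).
Proof.
exact: measurableT_comp (continuous_measurable_fun (@continuous_cos R)) (measurable_edotl t).
Qed.

Lemma measurable_sin_edot n (t : 'rV[R]_n) : measurable_fun setT (fun x => sin (edot x t)).
Proof.
exact: measurableT_comp (continuous_measurable_fun (@continuous_sin R)) (measurable_edotl t).
Qed.

Let cos_bound (x : R) : `|cos x| <= 1. Proof. by rewrite ler_norml cos_geN1 cos_le1. Qed.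
Let sin_bound (x : R) : `|sin x| <= 1. Proof. by rewrite ler_norml sin_geN1 sin_le1. Qed.

Lemma itg_gauss n a : 0 < a -> itg (lebesgue_rV R n) (gauss a).
Proof.
move=> a0; elim: n => [|n ih].
  apply/integrableP; split; first by apply/measurable_EFinP; exact: measurable_gauss.
  rewrite integral_dirac//= ?diracT ?mul1e ?ltry//.
  by do 2 apply: measurableT_comp => //; exact: measurable_gauss.
apply: (Rintegral_cons_prod (measurable_gauss _) (itg_gauss1 a0) ih _).1 => z.
rewrite /gauss/gauss1 edot_recl cons_rVK cons_rV0 -expRD; congr expR; ring.
Qed.

(** Induction on the dimension through the addition formula for [cos (t0 x0 + <x', t'>)]. The
    product of sines integrates to 0, being odd in the first coordinate, and the product of cosines
    factors. *)
Lemma Rintegral_gauss_cos n a (t : 'rV[R]_n) : 0 < a ->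
  \int[lebesgue_rV R n]_x (gauss a x * cos (edot x t)) =
  Num.sqrt (pi / a) ^+ n * expR (- (edot t t / (a *+ 4))).
Proof.
move=> a0; elim: n t => [|n ih] t.
  rewrite /Rintegral integral_dirac//; last first.
    apply/measurable_EFinP/measurable_funM; first exact: measurable_gauss.
    exact: measurable_cos_edot.
  rewrite diracE in_setT mul1e/= /gauss /edot !big_ord0.
  by rewrite mulr0 oppr0 mul0r oppr0 !expR0 cos0 !mulr1.
pose t0 := t ord0 ord0; pose t' := (uncons_rV t).2.
have mtx s : measurable_fun setT (fun x : R => s * x) by exact: measurable_funM.
have mcos s : measurable_fun setT (fun x : R => cos (s * x)).
  exact: measurableT_comp (continuous_measurable_fun (@continuous_cos R)) (mtx s).
have msin s : measurable_fun setT (fun x : R => sin (s * x)).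
  exact: measurableT_comp (continuous_measurable_fun (@continuous_sin R)) (mtx s).
pose c1 x := gauss1 a x * cos (t0 * x); pose s1 x := gauss1 a x * sin (t0 * x).
pose c' (x : 'rV[R]_n) := gauss a x * cos (edot x t').
pose s' (x : 'rV[R]_n) := gauss a x * sin (edot x t').
have ic1 : itg leb c1 by exact: itg_mul_bounded (itg_gauss1 a0) (mcos _) _.
have is1 : itg leb s1 by exact: itg_mul_bounded (itg_gauss1 a0) (msin _) _.
have ic' : itg (lebesgue_rV R n) c'.
  exact: itg_mul_bounded (itg_gauss _ a0) (measurable_cos_edot _) _.
have is' : itg (lebesgue_rV R n) s'.
  exact: itg_mul_bounded (itg_gauss _ a0) (measurable_sin_edot _) _.
have mtl : measurable_fun setT (fun v : 'rV[R]_n.+1 => (uncons_rV v).2).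
  exact: measurableT_comp measurable_snd (@measurable_uncons_rV R n).
have mprod (f : R -> R) g : itg leb f -> itg (lebesgue_rV R n) g ->
    measurable_fun setT (fun v : 'rV[R]_n.+1 => f (v ord0 ord0) * g (uncons_rV v).2).
  move=> iff ig; apply: measurable_funM; last exact: measurableT_comp (itg_measurable ig) mtl.
  exact: measurableT_comp (itg_measurable iff) (@measurable_rV_coord _ _ ord0).
have P (f : R -> R) g (iff : itg leb f) (ig : itg (lebesgue_rV R n) g) :=
  Rintegral_cons_prod (mprod f g iff ig) iff ig
    (fun z => congr2 (fun x v => f x * g v.2) (cons_rV0 z) (cons_rVK z)).
have [Ic IcE] := P _ _ ic1 ic'; have [Is IsE] := P _ _ is1 is'.
transitivity (\int[lebesgue_rV R n.+1]_x
  (c1 (x ord0 ord0) * c' (uncons_rV x).2 - s1 (x ord0 ord0) * s' (uncons_rV x).2)).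
  apply: eq_Rintegral => x _; rewrite /c1 /c' /s1 /s' /gauss /gauss1.
  rewrite !(edot_recl x) -/t0 -/t' cosD (mulrC t0).
  rewrite (mulrDr a) opprD expRD -expr2; ring.
rewrite RintegralB// IcE IsE (_ : \int[leb]_x s1 x = 0); last first.
  by apply: Rintegral_odd => // x; rewrite /s1 /gauss1 sqrrN mulrN sinN mulrN.
rewrite mul0r subr0 Rintegral_gauss1_cos// ih (exprS _ n) (edot_recl t).
rewrite -/t0 -/t' (mulrDl _ _ (a *+ 4)^-1) opprD expRD -expr2.
by rewrite mulrACA.
Qed.

End gaussian.

(** * Positive definiteness from a nonnegative transform *)

Section positive_definite.
Context (R : realType) (n : nat).
Notation vol := (lebesgue_rV R n).
Implicit Types (f : 'rV[R]_n -> R) (x y z t : 'rV[R]_n).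

Lemma edotC x y : edot x y = edot y x.
Proof. by apply: eq_bigr => i _; rewrite mulrC. Qed.

Lemma edotDl x y z : edot (x + y) z = edot x z + edot y z.
Proof. by rewrite -big_split; apply: eq_bigr => i _; rewrite mxE mulrDl. Qed.

Lemma edotNl x z : edot (- x) z = - edot x z.
Proof. by rewrite -sumrN; apply: eq_bigr => i _; rewrite mxE mulNr. Qed.

Lemma edotNN x : edot (- x) (- x) = edot x x.
Proof. by rewrite edotNl edotC edotNl opprK. Qed.

Lemma gaussN a x : gauss a (- x) = gauss a x.
Proof. by rewrite /gauss edotNN. Qed.

Lemma measurable_edot2 :
  measurable_fun setT (fun z : 'rV[R]_n * 'rV[R]_n => edot z.1 z.2).
Proof.
apply: (@measurable_sum _ _ _ _ _ _
  (fun i (z : 'rV[R]_n * 'rV[R]_n) => z.1 ord0 i * z.2 ord0 i)) => i.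
apply: measurable_funM.
  exact: measurableT_comp (@measurable_rV_coord R n i) measurable_fst.
exact: measurableT_comp (@measurable_rV_coord R n i) measurable_snd.
Qed.

(** The squared modulus of the exponential sum of [e^(i <x, t>)] over [x] in [C]. *)
Definition trig_sum (C : seq 'rV[R]_n) t : R :=
  (\sum_(x <- C) cos (edot x t)) ^+ 2 + (\sum_(x <- C) sin (edot x t)) ^+ 2.

Lemma trig_sum_ge0 C t : 0 <= trig_sum C t.
Proof. by rewrite addr_ge0 ?sqr_ge0. Qed.

Lemma trig_sum_le C t : trig_sum C t <= (size C)%:R ^+ 2 *+ 2.
Proof.
have B (g : 'rV[R]_n -> R) : (forall x, `|g x| <= 1) ->
    (\sum_(x <- C) g x) ^+ 2 <= (size C)%:R ^+ 2.
  move=> g1; rewrite -(real_normK (num_real (\sum_(x <- C) g x))) lerXn2r ?nnegrE//.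
  apply: (le_trans (ler_norm_sum _ _ _)).
  by rewrite -sum1_size natr_sum; apply: ler_sum.
by rewrite mulr2n lerD// B// => x; rewrite ler_norml ?cos_geN1 ?cos_le1 ?sin_geN1 ?sin_le1.
Qed.

Lemma measurable_trig_sum C : measurable_fun setT (trig_sum C).
Proof.
apply: measurable_funD; apply: measurable_funX.
  apply: (@measurable_sum _ _ _ _ _ _ (fun x t => cos (edot x t))) => x.
  by under eq_fun do rewrite edotC; exact: measurable_cos_edot.
apply: (@measurable_sum _ _ _ _ _ _ (fun x t => sin (edot x t))) => x.
by under eq_fun do rewrite edotC; exact: measurable_sin_edot.
Qed.

(* The terms in [sin (edot z t)] cancel by symmetry in [x] and [y]. *)
Lemma trig_sumE C t z : trig_sum C t * cos (edot z t) =
  \sum_(x <- C) \sum_(y <- C) cos (edot t (x - y - z)).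
Proof.
have E x y : cos (edot t (x - y - z)) =
    (cos (edot x t) * cos (edot y t) + sin (edot x t) * sin (edot y t)) * cos (edot z t) +
    (sin (edot x t) * cos (edot y t) - cos (edot x t) * sin (edot y t)) * sin (edot z t).
  by rewrite edotC !edotDl !edotNl cosB cosB sinB.
under eq_bigr do under eq_bigr do rewrite E.
under eq_bigr do rewrite big_split -!mulr_suml/= big_split sumrB/= -!mulr_sumr.
rewrite big_split/= -!mulr_suml sumrB !big_split/= -!mulr_suml /trig_sum.
ring.
Qed.

Lemma gauss_le1 (a : R) x : 0 <= a -> gauss a x <= 1.
Proof. by move=> a0; rewrite -expR0 ler_expR oppr_le0 mulr_ge0// edot_ge0. Qed.

Lemma gauss_subC (a : R) x y : gauss a (x - y) = gauss a (y - x).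
Proof. by rewrite -gaussN opprB. Qed.

Lemma measurable_gauss_sub (a : R) d : measurable_fun setT (fun z => gauss a (d - z)).
Proof.
under eq_fun do rewrite gauss_subC.
exact: measurableT_comp (@measurable_gauss _ _ _) (measurable_rV_trans d).
Qed.

Lemma itg_mul_gauss f (a : R) d : 0 <= a -> itg vol f ->
  itg vol (fun z => f z * gauss a (d - z)).
Proof.
move=> a0 iff; apply: (itg_mul_bounded (M := 1) iff (measurable_gauss_sub a d)) => z.
by rewrite ger0_norm ?gauss_ge0// gauss_le1.
Qed.

(** Each Gaussian of parameter [1 / (4 a)] is, up to the positive constant [S], the cosine transform
    of [gauss a]. Exchanging the integrals turns the pair sum into the integral of the cosine
    transform of [f] against the nonnegative weight [gauss a t * trig_sum C t]. *)
Lemma smoothed_pd f a (C : seq 'rV[R]_n) : 0 < a -> itg vol f ->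
  (forall t, 0 <= \int[vol]_x (f x * cos (edot x t))) ->
  0 <= \sum_(x <- C) \sum_(y <- C) \int[vol]_z (f z * gauss (a *+ 4)^-1 (x - y - z)).
Proof.
move=> a0 iff f_hat; set b := (a *+ 4)^-1.
have b0 : 0 <= b by rewrite invr_ge0 mulrn_wge0// ltW.
have ifb d := itg_mul_gauss d b0 iff.
pose S := Num.sqrt (pi / a) ^+ n.
have S0 : 0 < S by rewrite exprn_gt0// sqrtr_gt0 divr_gt0// pi_gt0.
pose h (p : 'rV[R]_n * 'rV[R]_n) :=
  (f p.1 * gauss a p.2) * (trig_sum C p.2 * cos (edot p.1 p.2)).
have cos_bound (x : R) : `|cos x| <= 1 by rewrite ler_norml cos_geN1 cos_le1.
have hbound (p : 'rV[R]_n * 'rV[R]_n) :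
    `|trig_sum C p.2 * cos (edot p.1 p.2)| <= (size C)%:R ^+ 2 *+ 2.
  rewrite normrM ger0_norm ?trig_sum_ge0// (le_trans _ (trig_sum_le C p.2))//.
  by rewrite ler_piMr ?trig_sum_ge0.
have ih : itg (vol \x vol)%E h.
  apply: (itg_mul_bounded (itg_prod iff (itg_gauss n a0)) _ hbound).
  apply: measurable_funM.
    exact: measurableT_comp (measurable_trig_sum C) measurable_snd.
  exact: measurableT_comp (continuous_measurable_fun (@continuous_cos R)) measurable_edot2.
have ih1 z : itg vol (fun t => h (z, t)).
  rewrite /h/=; under eq_fun do rewrite -mulrA.
  apply: itgZ; apply: (itg_mul_bounded (itg_gauss n a0) _ (fun t => hbound (z, t))).
  apply: measurable_funM; first exact: measurable_trig_sum.
  by under eq_fun do rewrite edotC; exact: measurable_cos_edot.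
have ifc t : itg vol (fun z => f z * cos (edot z t)).
  exact: itg_mul_bounded iff (measurable_cos_edot t) _.
have hE t z : h (z, t) = (gauss a t * trig_sum C t) * (f z * cos (edot z t)).
  by rewrite /h/=; ring.
have ih2 t : itg vol (fun z => h (z, t)).
  by under eq_fun do rewrite hE; exact: itgZ.
rewrite -(pmulr_rge0 _ S0).
suff -> : S * (\sum_(x <- C) \sum_(y <- C) \int[vol]_z (f z * gauss b (x - y - z))) =
    \int[vol]_z \int[vol]_t h (z, t).
  rewrite (Rintegral_swap ih)//; apply: Rintegral_ge0 => t _.
  under eq_Rintegral do rewrite hE.
  rewrite (RintegralZl _ measurableT (ifc t)); apply: mulr_ge0; last exact: f_hat.
  by apply: mulr_ge0; rewrite ?gauss_ge0 ?trig_sum_ge0.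
under [RHS]eq_Rintegral => z _.
  rewrite /h /=; under eq_Rintegral => t _.
    rewrite -mulrA trig_sumE mulr_sumr.
    under eq_bigr do rewrite mulr_sumr.
  over.
  have igc d : itg vol (fun t => gauss a t * cos (edot t d)).
    exact: itg_mul_bounded (itg_gauss n a0) (measurable_cos_edot d) _.
  rewrite RintegralZl; last first.
  - by apply: itg_sum => x; apply: itg_sum => y; exact: igc.
  - exact: measurableT.
  rewrite Rintegral_sum; last by move=> x; apply: itg_sum => y; exact: igc.
  under eq_bigr => x _.
    rewrite Rintegral_sum; last by move=> y; exact: igc.
    under eq_bigr => y _.
      rewrite Rintegral_gauss_cos// -/S (mulrC _ (a *+ 4)^-1) -/b -/(gauss b (x - y - z)).
    over.
    rewrite -mulr_sumr.
  over.
  rewrite -mulr_sumr mulrCA mulr_sumr.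
  under eq_bigr do rewrite mulr_sumr.
over.
rewrite RintegralZl//; last by apply: itg_sum => x; apply: itg_sum => y; exact: ifb.
congr (_ * _); rewrite Rintegral_sum; last by move=> x; apply: itg_sum => y; exact: ifb.
by apply: eq_bigr => x _; rewrite Rintegral_sum// => y; exact: ifb.
Qed.

(** With [q = k / n.+1], [expR (c k)] is the power [n.+1] of [expR (c q) >= c q]. This is one power
    more than [c ^+ n], which leaves a bound of the form [A / c]. *)
Lemma decay_near (k K eta : R) : 0 < k -> 0 < eta ->
  \forall c \near +oo, c ^+ n * expR (- ((c - 1) * k)) * K <= eta.
Proof.
move=> k0 eta0; pose q := k / n.+1%:R.
have q0 : 0 < q by rewrite divr_gt0.
have qi0 : 0 < q^-1 ^+ n.+1 by rewrite exprn_gt0// invr_gt0.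
pose L := `|K| + 1; pose A := expR k * L * q^-1 ^+ n.+1.
have L0 : 0 < L by rewrite ltr_wpDl.
near=> c.
have c0 : 0 < c by [].
have cA : A / eta <= c by [].
apply: (@le_trans _ _ (c ^+ n * expR (- ((c - 1) * k)) * L)).
  by rewrite ler_wpM2l ?mulr_ge0 ?exprn_ge0 ?expR_ge0 ?(ltW c0)// ler_wpDr// ler_norm.
have -> : - ((c - 1) * k) = k - n.+1%:R * (c * q).
  have qk : n.+1%:R * q = k by rewrite mulrCA divff ?mulr1 ?pnatr_eq0.
  by rewrite mulrCA qk; ring.
rewrite expRD expRN mulrC expRM_natl.
apply: (@le_trans _ _ (L * (c ^+ n * (expR k / (c * q) ^+ n.+1)))).
  rewrite ler_pM2l// ler_pM2l ?exprn_gt0// ler_pM2l ?expR_gt0//.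
  have cq0 : 0 < c * q by rewrite mulr_gt0.
  rewrite lef_pV2 ?posrE ?exprn_gt0 ?expR_gt0// lerXn2r ?nnegrE ?expR_ge0 ?(ltW cq0)//.
  by apply: (@le_trans _ _ (1 + c * q)); [rewrite lerDr|exact: expR_ge1Dx].
rewrite (_ : L * _ = A / c).
  by rewrite ler_pdivrMr// mulrC -ler_pdivrMr.
rewrite /A exprMn exprS invfM [in RHS]exprVn invfM; field.
by rewrite !expf_neq0 ?lt0r_neq0.
Unshelve. all: by end_near.
Qed.

Lemma edot0 t : edot t 0 = 0.
Proof. by rewrite /edot big1// => i _; rewrite mxE mulr0. Qed.

Lemma Rintegral_gauss_sub (a : R) d : 0 < a ->
  \int[vol]_z gauss a (d - z) = Num.sqrt (pi / a) ^+ n.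
Proof.
move=> a0; under eq_Rintegral do rewrite gauss_subC addrC.
rewrite Rintegral_translate; last exact: itg_gauss.
have := Rintegral_gauss_cos (0 : 'rV[R]_n) a0.
rewrite edot0 mul0r oppr0 expR0 mulr1 => <-.
by apply: eq_Rintegral => x _; rewrite edot0 cos0 mulr1.
Qed.

Lemma itg_gauss_sub (a : R) d : 0 < a -> itg vol (fun z => gauss a (d - z)).
Proof.
move=> a0; under eq_fun do rewrite gauss_subC addrC.
exact/itg_translate/itg_gauss.
Qed.

Lemma sqr_coord_le x i : x ord0 i ^+ 2 <= edot x x.
Proof.
rewrite /edot (bigD1 i)//= -expr2 lerDl.
by apply: sumr_ge0 => j _; rewrite -expr2 sqr_ge0.
Qed.

(** Normalised Gaussians form an approximate identity: close to [d] continuity controls [f d - f z],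
    and far from [d] the Gaussian is exponentially small in [c], which by [decay_near] beats the
    normalisation. *)
Lemma gauss_approx f d : continuous f -> itg vol f ->
  (Num.sqrt (pi / c) ^- n * \int[vol]_z (f z * gauss c (d - z))) @[c --> +oo] --> f d.
Proof.
move=> fc iff; apply/cvgrPdist_le => e e0.
have e20 : 0 < e / 2 by rewrite divr_gt0.
have /cvgrPdist_lt/(_ _ e20)/nbhs_ballP[del /= del0 fdel] := fc d.
(* [K] is the integral of the far bound in [pw] below, without the factor [D]. *)
pose K := \int[vol]_z `|f z| + `|f d| * Num.sqrt (pi / 1) ^+ n.
have K0 : 0 <= K.
  by rewrite addr_ge0 ?mulr_ge0 ?exprn_ge0 ?sqrtr_ge0//; apply: Rintegral_ge0.
have del20 : 0 < del ^+ 2 by rewrite exprn_gt0.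
near=> c.
have c1 : 1 <= c by [].
have c0 : 0 < c by exact: lt_le_trans ltr01 c1.
have dec : c ^+ n * expR (- ((c - 1) * del ^+ 2)) * K <= e / 2.
  by near: c; exact: decay_near.
set Z := Num.sqrt (pi / c) ^+ n.
have Z0 : 0 < Z by rewrite exprn_gt0// sqrtr_gt0 divr_gt0// pi_gt0.
(* A crude bound suffices: [sqrt (c / pi) <= c] because [c >= 1] and [pi >= 1]. *)
have Zc : Z^-1 <= c ^+ n.
  rewrite /Z -exprVn lerXn2r ?nnegrE ?invr_ge0 ?sqrtr_ge0 ?(ltW c0)//.
  have s0 : 0 < Num.sqrt (pi / c) by rewrite sqrtr_gt0 divr_gt0// pi_gt0.
  rewrite -[leRHS]invrK lef_pV2 ?posrE ?invr_gt0//.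
  have ci0 : 0 <= c^-1 by rewrite invr_ge0 ltW.
  rewrite -[leLHS](ger0_norm ci0) -sqrtr_sqr ler_wsqrtr// expr2 ler_wpM2r//.
  by apply: (@le_trans _ _ 1); [rewrite invf_le1|apply: le_trans (pi_ge2 R); rewrite ler1n].
pose D := expR (- ((c - 1) * del ^+ 2)).
(* The first term handles [z] within [del] of [d]. Beyond it, [gauss c <= D * gauss 1], where the
   remaining [gauss 1] keeps the constant [f d] integrable. *)
have pw z : `|(f d - f z) * gauss c (d - z)| <= e / 2 * gauss c (d - z) +
    D * (`|f z| + `|f d| * gauss 1 (d - z)).
  have R0 : 0 <= D * (`|f z| + `|f d| * gauss 1 (d - z)).
    by rewrite mulr_ge0 ?expR_ge0// addr_ge0// mulr_ge0 ?gauss_ge0.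
  rewrite normrM [X in _ * X]ger0_norm ?gauss_ge0//.
  have [close|far] := ltP (edot (d - z) (d - z)) (del ^+ 2).
    apply: ler_wpDr => //; rewrite ler_wpM2r ?gauss_ge0// ltW//.
    (* Library balls are sup-norm balls, so the Euclidean bound is passed to each coordinate. *)
    apply: fdel; split=> // i j; rewrite /ball/= (ord1 i).
    rewrite -(ltr_pXn2r (n := 2)) ?nnegrE ?normr_ge0 ?(ltW del0)// -normrX ger0_norm ?sqr_ge0//.
    apply: le_lt_trans close; apply: le_trans (sqr_coord_le _ j).
    by rewrite !mxE.
  apply: ler_wpDl; first by rewrite mulr_ge0 ?gauss_ge0 ?ltW.
  have gD : gauss c (d - z) <= D * gauss 1 (d - z).
    rewrite /D /gauss -expRD ler_expR; nra.
  apply: le_trans (ler_wpM2l (normr_ge0 _) gD) _.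
  rewrite mulrCA ler_wpM2l ?expR_ge0//.
  apply: (@le_trans _ _ ((`|f z| + `|f d|) * gauss 1 (d - z))).
    by rewrite ler_wpM2r ?gauss_ge0// distrC ler_normB.
  rewrite mulrDl lerD2r ler_piMr// gauss_le1//.
have igc := itg_gauss_sub d c0; have ig1 := itg_gauss_sub d (ltr01 : 0 < 1 :> R).
have ifg := itg_mul_gauss d (ltW c0) iff.
have idg : itg vol (fun z => (f d - f z) * gauss c (d - z)).
  by under eq_fun do rewrite mulrBl; apply: itgB => //; exact: itgZ.
have -> : f d - Z^-1 * \int[vol]_z (f z * gauss c (d - z)) =
    Z^-1 * \int[vol]_z ((f d - f z) * gauss c (d - z)).
  under [in RHS]eq_Rintegral do rewrite mulrBl.
  rewrite RintegralB//; last exact: itgZ.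
  rewrite (RintegralZl _ measurableT igc) Rintegral_gauss_sub// -/Z.
  by field; exact: lt0r_neq0.
rewrite normrM [X in X * _]ger0_norm; last by rewrite invr_ge0 ltW.
have i1 : itg vol (fun z => `|f z| + `|f d| * gauss 1 (d - z)).
  by apply: itgD; [exact: itg_norm|exact: itgZ].
have -> : e = Z^-1 * (e / 2 * Z) + e / 2 by field; exact: lt0r_neq0.
apply: (@le_trans _ _ (Z^-1 * (e / 2 * Z + D * K))); last first.
  rewrite mulrDr lerD2l; apply: le_trans dec; rewrite -mulrA ler_wpM2r//.
  by rewrite mulr_ge0 ?expR_ge0.
rewrite ler_pM2l ?invr_gt0//.
apply: le_trans (le_normr_Rintegral measurableT idg) _.
apply: (@le_trans _ _ (\int[vol]_z (e / 2 * gauss c (d - z) +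
    D * (`|f z| + `|f d| * gauss 1 (d - z))))).
  apply: le_Rintegral => //; first exact: itg_norm.
  by apply: itgD; exact: itgZ.
rewrite (Rintegral_lin _ _ igc i1) Rintegral_gauss_sub// -/Z RintegralD//.
- by rewrite (RintegralZl _ measurableT ig1) Rintegral_gauss_sub.
- exact: itg_norm.
- exact: itgZ.
Unshelve. all: by end_near.
Qed.

(** The pair sums of the Gaussian averages of [f] are nonnegative by [smoothed_pd] and converge to
    those of [f] by [gauss_approx]. *)
Lemma pd_of_cos_transform f (C : seq 'rV[R]_n) : continuous f -> itg vol f ->
  (forall t, 0 <= \int[vol]_x (f x * cos (edot x t))) ->
  0 <= \sum_(x <- C) \sum_(y <- C) f (x - y).
Proof.
move=> fc iff f_hat.
pose P d c : R := Num.sqrt (pi / c) ^- n * \int[vol]_z (f z * gauss c (d - z)).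
have : (\sum_(x <- C) \sum_(y <- C) P (x - y) c) @[c --> +oo] -->
    \sum_(x <- C) \sum_(y <- C) f (x - y).
  by apply: cvg_big => [|x _]; [exact: add_continuous|];
    apply: cvg_big => [|y _]; [exact: add_continuous|exact: gauss_approx].
move=> cvP; rewrite -(cvg_lim _ cvP)//; apply: limr_ge; first exact: cvgP cvP.
near=> c.
have c0 : 0 < c by [].
rewrite /P; under eq_bigr do rewrite -mulr_sumr.
rewrite -mulr_sumr mulr_ge0 ?invr_ge0 ?exprn_ge0 ?sqrtr_ge0//.
(* With [a = 1 / (4 c)] the smoothing parameter [1 / (4 a)] of [smoothed_pd] is [c]. *)
have a0 : 0 < (c *+ 4)^-1 by rewrite invr_gt0 mulrn_wgt0.
have := smoothed_pd C a0 iff f_hat.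
by rewrite (_ : ((c *+ 4)^-1 *+ 4)^-1 = c)//; field; exact: lt0r_neq0.
Unshelve. all: by end_near.
Qed.

End positive_definite.

(** * The three-point inequality *)

Section euclidean_norm.
Context (R : realType) (n : nat).
Implicit Types x y z : 'rV[R]_n.

Lemma edotDr x y z : edot x (y + z) = edot x y + edot x z.
Proof. by rewrite edotC edotDl !(edotC _ x). Qed.

Lemma edotNr x z : edot x (- z) = - edot x z.
Proof. by rewrite edotC edotNl edotC. Qed.

Lemma edotZl (k : R) x z : edot (k *: x) z = k * edot x z.
Proof. by rewrite /edot mulr_sumr; apply: eq_bigr => i _; rewrite mxE mulrA. Qed.

Lemma edotZr (k : R) x z : edot x (k *: z) = k * edot x z.
Proof. by rewrite edotC edotZl edotC. Qed.

Lemma edot_eq0 x : (edot x x == 0) = (x == 0).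
Proof.
apply/eqP/eqP => [x0|->]; last exact: edot0.
apply/rowP => i; rewrite mxE; apply/eqP; rewrite -sqrf_eq0.
by rewrite eq_le sqr_ge0 andbT -x0 sqr_coord_le.
Qed.

Lemma enorm_ge0 x : 0 <= enorm x. Proof. exact: sqrtr_ge0. Qed.

Lemma sqr_enorm x : enorm x ^+ 2 = edot x x.
Proof. by rewrite sqr_sqrtr// edot_ge0. Qed.

Lemma enormN x : enorm (- x) = enorm x.
Proof. by rewrite /enorm edotNN. Qed.

Lemma enormB x y : enorm (x - y) = enorm (y - x).
Proof. by rewrite -enormN opprB. Qed.

Lemma enorm0 : enorm (0 : 'rV[R]_n) = 0.
Proof. by rewrite /enorm edot0 sqrtr0. Qed.

Lemma enormZ (k : R) x : 0 <= k -> enorm (k *: x) = k * enorm x.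
Proof.
by move=> k0; rewrite /enorm edotZl edotZr mulrA -expr2 sqrtrM ?sqr_ge0// sqrtr_sqr ger0_norm.
Qed.

(** Cauchy-Schwarz, by expanding the square of [enorm y *: x - enorm x *: y]. Vectors of norm 0 are
    treated apart because the conclusion divides by [enorm x * enorm y]. *)
Lemma edot_le x y : edot x y <= enorm x * enorm y.
Proof.
have [x0|x0] := eqVneq (enorm x) 0.
  have /eqP : edot x x = 0 by rewrite -sqr_enorm x0 expr0n.
  by rewrite edot_eq0 => /eqP ->; rewrite edotC edot0 enorm0 mul0r.
have x0' : 0 < enorm x by rewrite lt_neqAle eq_sym x0 enorm_ge0.
have := edot_ge0 (enorm y *: x - enorm x *: y).
rewrite edotDl !edotDr !edotNl !edotNr !edotZl !edotZr (edotC y) -!sqr_enorm => h.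
have [y0|y0] := eqVneq (enorm y) 0.
  have /eqP : edot y y = 0 by rewrite -sqr_enorm y0 expr0n.
  by rewrite edot_eq0 => /eqP ->; rewrite edot0 enorm0 mulr0.
have y0' : 0 < enorm y by rewrite lt_neqAle eq_sym y0 enorm_ge0.
have xy0 : 0 < enorm x * enorm y by rewrite mulr_gt0.
by rewrite -(ler_pM2l xy0); nra.
Qed.

Lemma enormD x y : enorm (x + y) <= enorm x + enorm y.
Proof.
rewrite -(ler_pXn2r (n := 2)) ?nnegrE ?addr_ge0 ?enorm_ge0//.
rewrite sqr_enorm edotDl !edotDr (edotC y x) -!sqr_enorm.
by have := edot_le x y; nra.
Qed.

Lemma enorm_triangle z x y : enorm (x - y) <= enorm (x - z) + enorm (z - y).
Proof. by rewrite (_ : x - y = x - z + (z - y)) ?enormD// addrA subrK. Qed.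

Definition separated_by (r : R) (C : seq 'rV[R]_n) : Prop :=
  {in C &, forall x y, x != y -> r <= enorm (x - y)}.

End euclidean_norm.

Section three_point.
Context (R : realType) (n : nat) (r Rad : R).
Context (f2 : 'rV[R]_n -> R) (f3 : 'rV[R]_n -> 'rV[R]_n -> R).
Hypothesis f3_pd : pd_kernel f3.
Hypothesis h_diag : forall x, r <= enorm x <= Rad ->
  f2 x + f3 x 0 + f3 0 x + f3 x x <= 0.
Hypothesis h_far : forall x, Rad <= enorm x -> f2 x <= 0.
Hypothesis h_off : forall x y, r <= enorm x <= Rad -> r <= enorm y <= Rad ->
  r <= enorm (x - y) -> f3 x y <= 0.

Lemma pd_kernel_seq (T : choiceType) (f : T -> T -> R) (s : seq T) :
  pd_kernel f -> uniq s -> 0 <= \sum_(x <- s) \sum_(y <- s) f x y.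
Proof.
move=> [_ fpd] us; have := fpd [fset x in s]%fset (fun=> 1).
have P : perm_eq [fset x in s]%fset s.
  by apply: uniq_perm => // x; rewrite inE.
rewrite (perm_big _ P)/=.
under eq_bigr do rewrite (perm_big _ P)/=.
by under eq_bigr do under eq_bigr do rewrite !mul1r.
Qed.

(** Positivity of [f3] with unit weights on [D] and the origin: the off-diagonal terms are at most 0
    by [h_off], and [h_diag] bounds the diagonal terms together with the terms against the origin by
    [- f2 x]. *)
Lemma neighbor_sum_le (D : seq 'rV[R]_n) : uniq D ->
  {in D, forall x, r <= enorm x <= Rad} -> separated_by r D -> 0 < r ->
  \sum_(x <- D) f2 x <= f3 0 0.
Proof.
move=> uD Dr Dsep r0; have D0 : 0 \notin D.
  by apply/negP => /Dr; rewrite enorm0 leNgt r0.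
have := pd_kernel_seq f3_pd (_ : uniq (0 :: D)).
rewrite /= D0 uD => /(_ isT); rewrite big_cons big_cons.
under [X in _ + X]eq_bigr do rewrite big_cons.
rewrite big_split/= => h.
have : \sum_(x <- D) \sum_(y <- D) f3 x y <= \sum_(x <- D) f3 x x.
  rewrite big_seq [leRHS]big_seq; apply: ler_sum => x xD.
  rewrite (bigD1_seq x)//= -[leRHS]addr0 lerD2l.
  rewrite big_seq_cond; apply: sumr_le0 => y /andP[yD yx].
  by apply: h_off; rewrite ?Dr// Dsep// eq_sym.
have : \sum_(x <- D) (f2 x + f3 x 0 + f3 0 x + f3 x x) <= 0.
  by rewrite big_seq; apply: sumr_le0 => x xD; rewrite h_diag// Dr.
by rewrite !big_split/=; move: h; lra.
Qed.

(** For each fixed [y], the term [x = y] gives [f2 0], the points at distance more than [Rad] give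
    at most 0, and the others, translated by [- y], fall under [neighbor_sum_le]. *)
Lemma pair_sum_le (C : seq 'rV[R]_n) : uniq C -> separated_by r C -> 0 < r ->
  \sum_(x <- C) \sum_(y <- C) f2 (x - y) <= (size C)%:R * (f2 0 + f3 0 0).
Proof.
move=> uC Csep r0; rewrite exchange_big/= -sum1_size natr_sum mulr_suml.
rewrite big_seq [leRHS]big_seq; apply: ler_sum => y yC; rewrite mul1r.
rewrite (bigD1_seq y)//= subrr lerD2l.
pose N x := (x != y) && (enorm (x - y) <= Rad).
rewrite (bigID (fun x => enorm (x - y) <= Rad))/=.
apply: (@le_trans _ _ (\sum_(x <- C | N x) f2 (x - y))).
  rewrite gerDl; apply: sumr_le0 => x /andP[_]; rewrite -ltNge => xy.
  by rewrite h_far// ltW.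
rewrite -big_filter -(big_map (fun x => x - y) xpredT f2).
apply: neighbor_sum_le => //.
- by rewrite map_inj_uniq ?filter_uniq//; exact: addIr.
- move=> _ /mapP[x + ->]; rewrite mem_filter => /andP[/andP[xy ->] xC].
  by rewrite andbT Csep.
- move=> _ _ /mapP[x + ->] /mapP[z + ->]; rewrite !mem_filter => /andP[_ xC] /andP[_ zC].
  by rewrite opprB addrA subrK => xz; apply: Csep => //; apply: contra_neq xz => ->.
Qed.

End three_point.

(** * Cosine transforms and their behaviour near the origin *)

Section cos_transform.
Context (R : realType) (n : nat).
Notation vol := (lebesgue_rV R n).
Implicit Types (f : 'rV[R]_n -> R) (t : 'rV[R]_n).
Local Open Scope complex_scope.

Lemma Re_fourier f y :
  complex.Re (fourier f y) = \int[vol]_x (f x * cos (2 * pi * edot x y)).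
Proof.
by apply: eq_Rintegral => x _; rewrite /= mul0r subr0 cosN.
Qed.

(** The real part of [fourier f] at [t / (2 pi)] is the cosine transform at [t]. *)
Lemma cos_transform_ge0 f t : (forall y, 0 <= fourier f y) ->
  0 <= \int[vol]_x (f x * cos (edot x t)).
Proof.
move=> /(_ ((2 * pi)^-1 *: t)); rewrite lecE => /andP[_]; rewrite Re_fourier.
under eq_Rintegral do
  rewrite edotZr mulrA divff ?mul1r ?mulf_neq0 ?pnatr_eq0 ?(gt_eqF (pi_gt0 _))//.
by [].
Qed.

Lemma Rintegral_fourier0 f : fourier f 0 = 1 -> \int[vol]_x f x = 1.
Proof.
move=> f0; transitivity (complex.Re (fourier f 0)); last by rewrite f0.
by rewrite Re_fourier; apply: eq_Rintegral => x _; rewrite edot0 mulr0 cos0 mulr1.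
Qed.

End cos_transform.

Section cos_transform_continuity.
Context (R : realType) (n : nat).
Notation vol := (lebesgue_rV R n).
Implicit Types (f : 'rV[R]_n -> R) (t : 'rV[R]_n).

Lemma itg_mul_cos f t : itg vol f -> itg vol (fun x => f x * cos (edot x t)).
Proof.
move=> iff; apply: (itg_mul_bounded (M := 1) iff (measurable_cos_edot t)) => x.
by rewrite ler_norml cos_geN1 cos_le1.
Qed.

Lemma cvg_edot0 (t : nat -> 'rV[R]_n) x : (forall k, enorm (t k) <= k.+1%:R^-1) ->
  edot x (t k) @[k --> \oo] --> 0.
Proof.
move=> tk; apply/cvgr0Pnorm_le => e e0.
have := @cvg_harmonic R => /cvgr0Pnorm_le/(_ (e / (enorm x + 1))) h.
have x1 : 0 < enorm x + 1 by rewrite ltr_wpDl// enorm_ge0.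
near=> k.
have : `|harmonic k| <= e / (enorm x + 1) by near: k; apply: h; rewrite divr_gt0.
rewrite /harmonic/= ger0_norm// ler_pdivlMr// => hk.
have B y : edot x y <= enorm x * enorm y by exact: edot_le.
have : `|edot x (t k)| <= enorm x * enorm (t k).
  rewrite ler_norml B andbT lerNl -edotNr -[enorm (t k)]enormN; exact: edot_le.
move/le_trans; apply; apply: le_trans hk.
rewrite mulrC; apply: ler_pM; rewrite ?enorm_ge0// ?ler_wpDr//.
Unshelve. all: by end_near.
Qed.

(** If it failed there would be points [t k] of norm at most [1 / k.+1] violating the bound, while
    dominated convergence makes the transforms at [t k] tend to the integral of [f]. *)
Lemma cos_transform_near0 f (eta : R) : itg vol f -> 0 < eta ->
  exists2 del, 0 < del & forall t, enorm t <= del ->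
    \int[vol]_x f x - eta <= \int[vol]_x (f x * cos (edot x t)).
Proof.
move=> iff eta0; apply: contrapT => H.
have {}H (k : nat) : exists t, enorm t <= k.+1%:R^-1 /\
    \int[vol]_x (f x * cos (edot x t)) < \int[vol]_x f x - eta.
  apply: contrapT => K; apply: H; exists k.+1%:R^-1; first by rewrite invr_gt0.
  by move=> t tk; rewrite leNgt; apply/negP => lt; apply: K; exists t.
have [t tP] := choice H.
pose F k x := (f x * cos (edot x (t k)))%:E.
have iF k : vol.-integrable setT (F k) by exact: itg_mul_cos.
have : (\int[vol]_x F k x)%E @[k --> \oo] --> (\int[vol]_x (f x)%:E)%E.
  apply: (@dominated_cvg _ _ _ vol _ measurableT F _ (fun x => `|f x|%:E)) => //.
  - by move=> k; exact: measurable_int (iF k).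
  - move=> x _; apply/fine_cvgP; split; first exact: nearW.
    rewrite -[X in _ --> X]mulr1; apply: cvgM; first exact: cvg_cst.
    rewrite -(@cos0 R); apply: continuous_cvg; first exact: continuous_cos.
    by apply: cvg_edot0 => k; exact: (tP k).1.
  - exact: itg_norm.
  - move=> k x _; rewrite lee_fin normrM ler_piMr//.
    by rewrite ler_norml cos_geN1 cos_le1.
rewrite -(EFin_Rintegral iff) => /fine_cvg/cvgrPdist_lt/(_ _ eta0)[k _ /(_ k (leqnn k))].
rewrite /= => lt; have := (tP k).2; rewrite ltNge => /negP; apply.
rewrite lerBlDl -lerBlDr ltW//; apply: le_lt_trans lt; exact: ler_norm.
Qed.

End cos_transform_continuity.

(** * Balls and Gaussian sums *)

Section ball_volume.
Context (R : realType) (n : nat).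
Notation vol := (lebesgue_rV R n).

Lemma lebesgue_eball_translate (c : 'rV[R]_n) rho : vol (eball c rho) = vol (eball 0 rho).
Proof.
rewrite -(lebesgue_rV_translate c (measurable_eball _ _)).
by congr (vol _); apply/seteqP; split => x; rewrite /eball/= subr0 [c + x]addrC addrK.
Qed.

Lemma lebesgue_eball_scale (k rho : R) : 0 < k ->
  vol (eball 0 (k * rho)) = ((k ^+ n)%:E * vol (eball 0 rho))%E.
Proof.
move=> k0; rewrite -(lebesgue_rV_affine 0 k0 (measurable_eball _ _)).
congr (_ * vol _)%E; apply/seteqP; split => x;
  by rewrite /eball/= add0r !subr0 enormZ ?(ltW k0)// ler_pM2l.
Qed.

(** Cubes have explicit volume; comparing balls with them shows that ball volumes are finite and
    positive. *)
Let box (a : R) : set 'rV[R]_n := [set v | forall i, `[- a, a]%classic (v ord0 i)].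

Let measurable_box a : measurable (box a).
Proof.
rewrite (_ : box a = \bigcap_(i in setT) (@rV_coord R n i @^-1` `[- a, a]%classic)).
  apply: fin_bigcap_measurable => // i _; rewrite -[X in measurable X]setTI.
  exact: measurable_rV_coord.
by apply/seteqP; split => v /= vA; move=> i *; exact: vA.
Qed.

Let lebesgue_box a : 0 <= a -> vol (box a) = ((a *+ 2) ^+ n)%:E.
Proof.
move=> a0; have -> := @lebesgue_rV_box R n (fun=> `[- a, a]%classic)
  (fun=> measurable_itv _).
under eq_bigr do rewrite lebesgue_measure_itv/=.
have E : (if (- a)%:E < a%:E then a%:E - (- a)%:E else 0)%E = (a *+ 2)%:E.
  rewrite lte_fin; case: ifPn => [_|]; first by rewrite -EFinB opprK mulr2n.
  rewrite -leNgt => aN; congr EFin; rewrite (_ : a = 0) ?mul0rn//; lra.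
under eq_bigr do rewrite E.
by rewrite prodEFin prodr_const card_ord.
Qed.

Lemma lebesgue_eball_lty (c : 'rV[R]_n) rho : (vol (eball c rho) < +oo)%E.
Proof.
rewrite lebesgue_eball_translate; apply: (@le_lt_trans _ _ (vol (box `|rho|))).
  apply: le_measure; rewrite ?inE; [exact: measurable_eball|exact: measurable_box|].
  move=> x; rewrite /eball/= subr0 => xr i; rewrite /= in_itv/= -ler_norml.
  rewrite -(ler_pXn2r (n := 2)) ?nnegrE// real_normK ?num_real//.
  apply: le_trans (sqr_coord_le _ i) _.
  rewrite -sqr_enorm lerXn2r ?nnegrE ?enorm_ge0//.
  exact: le_trans xr (ler_norm _).
by rewrite lebesgue_box ?ltry.
Qed.

Lemma lebesgue_eball_gt0 (c : 'rV[R]_n) rho : 0 < rho -> (0 < vol (eball c rho))%E.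
Proof.
(* Points of this cube have squared norm at most [n * a ^+ 2 <= rho ^+ 2]; dividing by [n.+1] also
   covers dimension 0. *)
move=> rho0; rewrite lebesgue_eball_translate; pose a := rho / n.+1%:R.
have a0 : 0 < a by rewrite divr_gt0.
apply: (@lt_le_trans _ _ (vol (box a))).
  by rewrite lebesgue_box ?ltW// lte_fin exprn_gt0// mulrn_wgt0.
apply: le_measure; rewrite ?inE; [exact: measurable_box|exact: measurable_eball|].
move=> x xa; rewrite /eball/= subr0 -(ler_pXn2r (n := 2)) ?nnegrE ?enorm_ge0 ?(ltW rho0)//.
rewrite sqr_enorm (_ : rho = n.+1%:R * a); last first.
  by rewrite mulrCA divff ?mulr1// pnatr_eq0.
apply: (@le_trans _ _ (\sum_(i < n) a ^+ 2)).
  apply: ler_sum => i _; rewrite -expr2 -[leLHS]real_normK ?num_real//.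
  by rewrite lerXn2r ?nnegrE ?(ltW a0)// ler_norml; have := xa i; rewrite /= in_itv/=.
rewrite sumr_const card_ord -(mulr_natl (a ^+ 2)) [leRHS]exprMn.
apply: ler_wpM2r; rewrite ?sqr_ge0//.
by rewrite -natrX ler_nat (leq_trans (leqnSn n))// expnS expn1 leq_pmulr.
Qed.

Definition ball_vol rho : R := fine (vol (eball 0 rho)).

Lemma ball_volE (c : 'rV[R]_n) rho : vol (eball c rho) = (ball_vol rho)%:E.
Proof.
by rewrite lebesgue_eball_translate /ball_vol fineK// ge0_fin_numE// lebesgue_eball_lty.
Qed.

Lemma ball_vol_gt0 rho : 0 < rho -> 0 < ball_vol rho.
Proof. by move=> r0; rewrite -lte_fin -(ball_volE 0) lebesgue_eball_gt0. Qed.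

Lemma ball_vol_scale k rho : 0 < k -> ball_vol (k * rho) = k ^+ n * ball_vol rho.
Proof.
by move=> k0; apply: EFin_inj; rewrite EFinM -!(ball_volE 0) lebesgue_eball_scale.
Qed.

Lemma itg_indic_eball (c : 'rV[R]_n) rho : itg vol (\1_(eball c rho) : 'rV[R]_n -> R).
Proof.
have mB := measurable_eball c rho; apply/integrableP; split.
  exact/measurable_EFinP/measurable_indic.
under eq_integral do rewrite /= ger0_norm//.
by rewrite integral_indic// setIT lebesgue_eball_lty.
Qed.

Lemma Rintegral_indic_eball (c : 'rV[R]_n) rho :
  \int[vol]_x (\1_(eball c rho) x : R) = ball_vol rho.
Proof.
rewrite /Rintegral integral_indic//; last exact: measurable_eball.
by congr fine; rewrite setIT; exact: lebesgue_eball_translate.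
Qed.

End ball_volume.

(** * Gaussian convolution and Gaussian sums over separated points *)

Section gaussian_sums.
Context (R : realType) (n : nat).
Notation vol := (lebesgue_rV R n).
Notation Z a := (Num.sqrt (pi / a) ^+ n : R).
Implicit Types (x y u : 'rV[R]_n) (a s : R).

Lemma Z_gt0 a : 0 < a -> 0 < Z a.
Proof. by move=> a0; rewrite exprn_gt0// sqrtr_gt0 divr_gt0// pi_gt0. Qed.

(* The parallelogram law around the midpoint of [x] and [y]. *)
Lemma gauss_mul a x y u : gauss a (x - u) * gauss a (y - u) =
  gauss (a / 2) (x - y) * gauss (a *+ 2) (2^-1 *: (x + y) - u).
Proof.
rewrite /gauss -!expRD; congr expR.
rewrite !edotDl !edotDr !edotNl !edotNr !edotZl !edotZr !edotDl !edotDr.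
by rewrite (edotC y x) !(edotC u); field.
Qed.

(** By [gauss_mul], only a translated Gaussian of parameter [4 s] remains under the integral. After
    normalisation this is the identity [p_s = p_2s * p_2s]. *)
Lemma Rintegral_gauss_mul s x y : 0 < s ->
  itg vol (fun u => gauss (s *+ 2) (x - u) * gauss (s *+ 2) (y - u)) /\
  \int[vol]_u (gauss (s *+ 2) (x - u) * gauss (s *+ 2) (y - u)) =
  Z (s *+ 2) ^+ 2 / Z s * gauss s (x - y).
Proof.
move=> s0; have s20 : 0 < s *+ 2 *+ 2 by rewrite !mulrn_wgt0.
have E u : gauss (s *+ 2) (x - u) * gauss (s *+ 2) (y - u) =
    gauss s (x - y) * gauss (s *+ 2 *+ 2) (2^-1 *: (x + y) - u).
  have s2 : s *+ 2 / 2 = s by field.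
  by rewrite gauss_mul s2.
split; first by under eq_fun do rewrite E; apply: itgZ; exact: itg_gauss_sub.
under eq_Rintegral do rewrite E.
rewrite RintegralZl//; last exact: itg_gauss_sub.
rewrite Rintegral_gauss_sub// mulrC; congr (_ * _).
(* What remains is [Z (4 s) * Z s = Z (2 s) ^+ 2]. *)
have Zs := Z_gt0 s0; apply: (mulIf (lt0r_neq0 Zs)); rewrite divfK ?lt0r_neq0//.
rewrite -exprMn -exprAC; congr (_ ^+ n).
have pi0 := pi_ge0 R.
rewrite sqr_sqrtr; last by rewrite divr_ge0// mulrn_wge0// ltW.
rewrite -sqrtrM; last by rewrite divr_ge0// ltW.
rewrite (_ : pi / (s *+ 2 *+ 2) * (pi / s) = (pi / (s *+ 2)) ^+ 2); last by field; exact: lt0r_neq0.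
by rewrite sqrtr_sqr ger0_norm// divr_ge0// mulrn_wge0// ltW.
Qed.

(** The balls of radius [r / 3] around the points are disjoint. On each, the value at the centre is
    at most a constant times a wider Gaussian, so the sum times the ball volume is at most one
    Gaussian integral. *)
Lemma separated_gauss_sum (r : R) : 0 < r ->
  exists2 K, 0 < K & forall C x, uniq C -> separated_by r C ->
    \sum_(y <- C) gauss 1 (x - y) <= K.
Proof.
move=> r0; have r30 : 0 < r / 3 by rewrite divr_gt0.
pose v := ball_vol n (r / 3); have v0 : 0 < v by exact: ball_vol_gt0.
have h0 : 0 < 2^-1 :> R by rewrite invr_gt0.
exists (expR (r ^+ 2) * Z 2^-1 / v).
  by rewrite divr_gt0// mulr_gt0 ?expR_gt0 ?Z_gt0.
move=> C x uC Csep; rewrite ler_pdivlMr// mulr_suml.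
have -> : \sum_(y <- C) gauss 1 (x - y) * v =
    \int[vol]_u \sum_(y <- C) gauss 1 (x - y) * \1_(eball y (r / 3)) u.
  rewrite Rintegral_sum => [|y]; last by apply: itgZ; exact: itg_indic_eball.
  apply: eq_bigr => y _; rewrite RintegralZl ?Rintegral_indic_eball//.
  exact: itg_indic_eball.
rewrite -(Rintegral_gauss_sub x h0) -RintegralZl//; last exact: itg_gauss_sub.
apply: le_Rintegral => //.
- by apply: itg_sum => y; apply: itgZ; exact: itg_indic_eball.
- by apply: itgZ; exact: itg_gauss_sub.
move=> u _.
have B y : eball y (r / 3) u -> gauss 1 (x - y) <= expR (r ^+ 2) * gauss 2^-1 (x - u).
  rewrite /eball/= => uy; rewrite /gauss -expRD ler_expR.
  have : edot (u - y) (u - y) <= r ^+ 2.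
    rewrite -sqr_enorm lerXn2r ?nnegrE ?enorm_ge0 ?(ltW r0)//.
    by rewrite (le_trans uy)// ler_pdivrMr//; lra.
  (* With [p = x - u] and [q = u - y], nonnegativity of [|p + 2 q|^2] gives
     [|p + q|^2 >= |p|^2 / 2 - |q|^2]. *)
  have := edot_ge0 (x - u + (u - y) *+ 2).
  rewrite (_ : x - y = (x - u) + (u - y)); last by rewrite addrA subrK.
  move: (x - u) (u - y) => p q.
  rewrite -scaler_nat !edotDl !edotDr !edotZl !edotZr (edotC q p).
  lra.
(* At most one ball contains [u], since two would put their centres within [2 r / 3 < r]. *)
have [[y yC uy]|none] := pselect (exists2 y, y \in C & eball y (r / 3) u); last first.
  rewrite big_seq big1 => [|y yC]; first by rewrite mulr_ge0 ?expR_ge0.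
  by rewrite indicE memNset ?mulr0// => uy; apply: none; exists y.
rewrite (bigD1_seq y)//= indicE mem_set// mulr1 big_seq_cond big1 ?addr0 ?B// => z /andP[zC zy].
rewrite indicE memNset ?mulr0// /eball/= => uz.
have := Csep _ _ zC yC zy; apply/negP; rewrite -ltNge.
apply: le_lt_trans (enorm_triangle u _ _) _; rewrite enormB.
by move: uy; rewrite /eball/= => uy; apply: le_lt_trans (lerD uz uy) _; lra.
Qed.

End gaussian_sums.

(** * Lower and upper bounds for heat kernel pair sums *)

Section packing_bound.
Context (R : realType) (n : nat).
Notation vol := (lebesgue_rV R n).
Notation Z a := (Num.sqrt (pi / a) ^+ n : R).
Implicit Types (x y u : 'rV[R]_n) (C : seq 'rV[R]_n).

(** The Gaussian [p_s] of mass one; [s] multiplies the squared norm in the exponent, so a small [s]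
    means a wide Gaussian. *)
Definition heat (s : R) x : R := (Z s)^-1 * gauss s x.

Lemma expR_decay (k eta : R) : 0 < eta -> eta^-1 <= k -> expR (- k) <= eta.
Proof.
move=> eta0 etak; have k0 : 0 < k by apply: lt_le_trans etak; rewrite invr_gt0.
rewrite expRN -[leRHS]invrK lef_pV2 ?posrE ?expR_gt0 ?invr_gt0//.
by apply: le_trans etak _; apply: le_trans (expR_ge1Dx _); rewrite lerDr.
Qed.

(** The pair sum is the integral of [P ^+ 2], where [P] has mass [N] concentrated near the ball [B].
    Cauchy-Schwarz on [B] is used in the linear form [P ^+ 2 >= 2 tau P - tau ^+ 2], and the mass
    outside [B] is handled by replacing [P] with a slightly smaller [Q]. *)
Lemma heat_pair_sum_ge (s eta : R) : 0 < s -> 0 < eta ->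
  exists2 L, 0 < L & forall rho C, 0 <= rho -> {in C, forall x, enorm x <= rho} ->
    (size C)%:R ^+ 2 * (1 - eta *+ 2) <=
    ball_vol n (rho + L) * \sum_(x <- C) \sum_(y <- C) heat s (x - y).
Proof.
move=> s0 eta0; have s20 : 0 < s *+ 2 by rewrite mulrn_wgt0.
have Zs := @Z_gt0 R n _ s0; have Z2 := @Z_gt0 R n _ s20.
(* The value [eta'] is such that [expR (- (s L^2)) <= eta'] gives [kap * Z s <= eta]. By
   [expR_decay] this holds once [s L^2 = 1 / eta'], which defines [L]. *)
pose eta' := eta * Z (s *+ 2) / Z s.
have eta'0 : 0 < eta' by rewrite divr_gt0// mulr_gt0.
pose L := Num.sqrt (eta'^-1 / s).
have L0 : 0 < L by rewrite sqrtr_gt0 divr_gt0// invr_gt0.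
exists L => // rho C rho0 Crho; set B := eball (0 : 'rV[R]_n) (rho + L).
(* At distance at least [L] from its centre, [heat (2 s)] is at most [kap * gauss s]: one of the two
   factors [gauss s] of [gauss (2 s)] is bounded by its value at [L]. *)
pose kap := expR (- (s * L ^+ 2)) / Z (s *+ 2).
have kap0 : 0 <= kap by rewrite divr_ge0 ?expR_ge0// ltW.
have kapZ : kap * Z s <= eta.
  have E : expR (- (s * L ^+ 2)) <= eta'.
    apply: expR_decay => //.
    rewrite sqr_sqrtr; last by apply: divr_ge0; rewrite ?invr_ge0 ltW.
    by rewrite mulrC divfK// lt0r_neq0.
  rewrite (_ : eta = eta' / Z (s *+ 2) * Z s); last first.
    by rewrite /eta'; field; rewrite !lt0r_neq0.
  by rewrite /kap !ler_pM2r ?invr_gt0.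
pose P u := \sum_(x <- C) heat (s *+ 2) (x - u).
have iheat a x : 0 < a -> itg vol (fun u => heat a (x - u)).
  by move=> a0; apply: itgZ; exact: itg_gauss_sub.
have PE u : P u ^+ 2 = \sum_(x <- C) \sum_(y <- C)
    (Z (s *+ 2))^-1 ^+ 2 * (gauss (s *+ 2) (x - u) * gauss (s *+ 2) (y - u)).
  rewrite expr2 /P mulr_suml; apply: eq_bigr => x _; rewrite mulr_sumr.
  by apply: eq_bigr => y _; rewrite /heat; ring.
have iP2 : itg vol (fun u => P u ^+ 2).
  under eq_fun do rewrite PE.
  apply: itg_sum => x; apply: itg_sum => y; apply: itgZ.
  exact: (Rintegral_gauss_mul x y s0).1.
have IP2 : \int[vol]_u (P u ^+ 2) = \sum_(x <- C) \sum_(y <- C) heat s (x - y).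
  under eq_Rintegral do rewrite PE.
  have i2 x y := (Rintegral_gauss_mul x y s0).1.
  rewrite Rintegral_sum; last by move=> x; apply: itg_sum => y; exact/itgZ/i2.
  apply: eq_bigr => x _; rewrite Rintegral_sum; last by move=> y; exact/itgZ/i2.
  apply: eq_bigr => y _; rewrite (RintegralZl _ measurableT (i2 x y)).
  rewrite (Rintegral_gauss_mul x y s0).2 /heat; field.
  by rewrite !lt0r_neq0.
rewrite -IP2; set V := ball_vol n (rho + L).
have V0 : 0 < V by apply: ball_vol_gt0; rewrite ltr_wpDl.
(* [tau] is the mean of a function of total mass [N] spread over [B], the value that optimises the
   linearised bound when [eta] is ignored. *)
pose N : R := (size C)%:R; pose tau := N / V.
have tau0 : 0 <= tau by rewrite divr_ge0// ltW.
pose Q u := \sum_(x <- C) (heat (s *+ 2) (x - u) - kap * gauss s (x - u)).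
have ig x : itg vol (fun u => heat (s *+ 2) (x - u) - kap * gauss s (x - u)).
  by apply: itgB; [exact: iheat|apply: itgZ; exact: itg_gauss_sub].
have iQ : itg vol Q by exact: itg_sum.
have IQ : N * (1 - eta) <= \int[vol]_u Q u.
  rewrite Rintegral_sum// /N -sum1_size natr_sum mulr_suml; apply: ler_sum => x _.
  rewrite mul1r RintegralB//; [|exact: iheat|apply: itgZ; exact: itg_gauss_sub].
  rewrite !RintegralZl//; [|exact: itg_gauss_sub..].
  by rewrite !Rintegral_gauss_sub// mulVf ?lt0r_neq0// lerD2l lerN2.
(* On [B], [P ^+ 2 >= tau *+ 2 * P - tau ^+ 2]; off [B] every term of [Q] is at
   most 0. *)
have : \int[vol]_u (tau *+ 2 * Q u + (- tau ^+ 2) * \1_B u) <= \int[vol]_u (P u ^+ 2).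
  apply: le_Rintegral => //.
    by apply: itgD; [exact: itgZ|apply: itgZ; exact: itg_indic_eball].
  move=> u _; have [uB|uB] := pselect (B u).
    rewrite indicE mem_set// mulr1.
    have QP : Q u <= P u.
      by apply: ler_sum => x _; rewrite gerBl mulr_ge0 ?gauss_ge0.
    have := sqr_ge0 (P u - tau); nra.
  rewrite indicE memNset// mulr0 addr0 (le_trans _ (sqr_ge0 _))//.
  rewrite mulr_ge0_le0 ?mulrn_wge0// /Q big_seq; apply: sumr_le0 => x xC.
  have xu : L ^+ 2 <= edot (x - u) (x - u).
    rewrite -sqr_enorm lerXn2r ?nnegrE ?enorm_ge0 ?(ltW L0)//.
    rewrite leNgt; apply/negP => xuL; apply: uB; rewrite /B /eball/= subr0.
    rewrite -[u](subrK x) addrC (le_trans (enormD _ _))// lerD ?Crho//.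
    by rewrite enormB ltW.
  rewrite subr_le0 /heat /kap mulrAC mulrC ler_wpM2r ?invr_ge0 ?(ltW Z2)//.
  by rewrite /gauss -expRD ler_expR; nra.
rewrite (Rintegral_lin _ _ iQ (itg_indic_eball _ _)) Rintegral_indic_eball -/V => h.
have : tau *+ 2 * (N * (1 - eta)) - tau ^+ 2 * V <= \int[vol]_u (P u ^+ 2).
  by apply: le_trans h; rewrite mulNr lerD2r ler_wpM2l// mulrn_wge0.
rewrite -(ler_pM2l V0) => /(le_trans _); apply.
(* An equality: [2 N^2 (1 - eta) - N^2 = N^2 (1 - 2 eta)]. *)
rewrite -/N /tau le_eqVlt; apply/orP; left; apply/eqP; field; exact: lt0r_neq0.
Qed.

Lemma itg_heat (s : R) : 0 < s -> itg vol (heat s).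
Proof. by move=> s0; apply: itgZ; exact: itg_gauss. Qed.

Lemma Rintegral_heat_cos (s : R) t : 0 < s ->
  \int[vol]_x (heat s x * cos (edot x t)) = expR (- (edot t t / (s *+ 4))).
Proof.
move=> s0; under eq_Rintegral do rewrite /heat -mulrA.
rewrite RintegralZl//; last exact/itg_mul_cos/itg_gauss.
by rewrite Rintegral_gauss_cos// mulKf// lt0r_neq0// Z_gt0.
Qed.

Lemma continuous_scale (c : R) (g : 'rV[R]_n -> R) :
  continuous g -> continuous (fun x => c * g x).
Proof. by move=> cg x; apply: continuousM; [exact: cst_continuous|exact: cg]. Qed.

Lemma continuous_edot_diag : continuous (fun x => edot x x).
Proof.
move=> x; apply: cvg_big => [||i _]; [exact: add_continuous|exact: (@nbhs_filter _ x)|].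
have ci : continuous (fun x : 'rV[R]_n => x ord0 i) by exact: coord_continuous.
exact: (continuousM (ci x) (ci x)).
Qed.

Lemma continuous_heat (s : R) : continuous (heat s).
Proof.
apply: continuous_scale => x; rewrite (_ : gauss s = expR \o (fun x => - s * edot x x)).
  apply: continuous_comp; first exact: (@continuous_scale (- s) _ continuous_edot_diag).
  exact: continuous_expR.
by apply/funext => y; rewrite /gauss /= mulNr.
Qed.

(** The difference of the two sides is the pair sum of [F], whose cosine transform is nonnegative:
    near the origin [(1 + eta) f] outweighs [heat s], and away from it [eta * heat 1] does. *)
Lemma heat_pair_sum_le (f : 'rV[R]_n -> R) (eta : R) : continuous f -> itg vol f ->
  \int[vol]_x f x = 1 -> (forall t, 0 <= \int[vol]_x (f x * cos (edot x t))) ->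
  0 < eta ->
  exists2 s, 0 < s & forall C, \sum_(x <- C) \sum_(y <- C) heat s (x - y) <=
    (1 + eta) * (\sum_(x <- C) \sum_(y <- C) f (x - y)) +
    eta * (\sum_(x <- C) \sum_(y <- C) heat 1 (x - y)).
Proof.
move=> fc iff f1 f_hat eta0.
have e1 : 0 < 1 + eta by rewrite addr_gt0.
(* This tolerance is chosen because [(1 + eta) * (1 - eta / (1 + eta)) = 1], the maximum of the
   transform of [heat s]. *)
have [del del0 near0] := cos_transform_near0 iff (divr_gt0 eta0 e1).
(* [B] satisfies [B / 4 * del ^+ 2 = 1 / eta]. With [s = 1 / (1 + B)], the transform of [heat s] is
   that of [heat 1] times [expR (- (B |t|^2 / 4))], a factor at most [eta] beyond [del]. *)
pose B := 4 / (eta * del ^+ 2); have B0 : 0 < B by rewrite divr_gt0// mulr_gt0// exprn_gt0.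
have B1 : 0 < 1 + B by rewrite addr_gt0.
pose s := (1 + B)^-1; have s0 : 0 < s by rewrite invr_gt0.
exists s => // C; rewrite -subr_ge0.
pose F x := (1 + eta) * f x + 1 * (eta * heat 1 x + (-1) * heat s x).
have h1 : 0 < 1 :> R by [].
have iF : itg vol F.
  apply: itgD; first exact: itgZ.
  by apply: itgZ; apply: itgD; apply: itgZ; exact: itg_heat.
have Fc : continuous F.
  have cH := @continuous_scale eta _ (@continuous_heat 1).
  have cs := @continuous_scale (-1) _ (@continuous_heat s).
  have cHs := @continuous_scale 1 _ (fun x => continuousD (cH x) (cs x)).
  by move=> x; exact: (continuousD (@continuous_scale (1 + eta) _ fc x) (cHs x)).
have F_hat t : 0 <= \int[vol]_x (F x * cos (edot x t)).
  have ic g : itg vol g -> itg vol (fun x => g x * cos (edot x t)) by exact: itg_mul_cos.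
  have ih1 := ic _ (itg_heat h1); have ihs := ic _ (itg_heat s0).
  have -> : \int[vol]_x (F x * cos (edot x t)) =
      (1 + eta) * (\int[vol]_x (f x * cos (edot x t))) +
      1 * (eta * expR (- (edot t t / 4)) + (-1) * expR (- (edot t t / (s *+ 4)))).
    rewrite -(Rintegral_heat_cos t h1) -(Rintegral_heat_cos t s0) -Rintegral_lin//.
    rewrite -Rintegral_lin; [|exact: ic|].
      by apply: eq_Rintegral => x _; rewrite /F; ring.
    by apply: itgD; exact: itgZ.
  have q0 := edot_ge0 t.
  have Es : edot t t / (s *+ 4) = edot t t / 4 + B / 4 * edot t t.
    by rewrite /s; field; exact: lt0r_neq0.
  have [tdel|tdel] := leP (enorm t) del.
    have := near0 t tdel; rewrite f1 => h.
    have : 1 <= (1 + eta) * \int[vol]_x (f x * cos (edot x t)).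
      apply: (@le_trans _ _ ((1 + eta) * (1 - eta / (1 + eta)))); last by rewrite ler_pM2l.
      rewrite (_ : _ * _ = 1)//; field; exact: lt0r_neq0.
    have : expR (- (edot t t / (s *+ 4))) <= 1.
      by rewrite -expR0 ler_expR oppr_le0 divr_ge0// mulrn_wge0// ltW.
    have := mulr_ge0 (ltW eta0) (expR_ge0 (- (edot t t / 4))); lra.
  apply: addr_ge0; first by apply: mulr_ge0 => //; exact: ltW.
  rewrite mul1r mulN1r subr_ge0 Es opprD expRD mulrC ler_wpM2r ?expR_ge0//.
  apply: expR_decay => //.
  apply: (@le_trans _ _ (B / 4 * del ^+ 2)).
    rewrite le_eqVlt; apply/orP; left; apply/eqP; rewrite /B; field.
    by rewrite !lt0r_neq0.
  apply: ler_wpM2l; first by rewrite divr_ge0 ?(ltW B0).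
  by rewrite -sqr_enorm lerXn2r ?nnegrE ?enorm_ge0 ?(ltW del0)// ltW.
have := pd_of_cos_transform C Fc iF F_hat; congr (0 <= _).
rewrite /F; under eq_bigr do rewrite big_split/=.
rewrite big_split/=; under eq_bigr do rewrite -mulr_sumr.
under [X in _ + X = _]eq_bigr do rewrite -mulr_sumr big_split/= -!mulr_sumr.
have hE a : \sum_(x <- C) \sum_(y <- C) heat a (x - y) =
    (Z a)^-1 * \sum_(x <- C) \sum_(y <- C) gauss a (x - y).
  by rewrite mulr_sumr; apply: eq_bigr => x _; rewrite mulr_sumr.
by rewrite -!mulr_sumr big_split/= -!mulr_sumr !hE; ring.
Qed.

End packing_bound.

(** * Counting points and density *)

Section packing_count.
Context (R : realType) (n : nat) (r Rad : R).
Context (f2 : 'rV[R]_n -> R) (f3 : 'rV[R]_n -> 'rV[R]_n -> R).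
Notation vol := (lebesgue_rV R n).
Hypothesis r0 : 0 < r.
Hypothesis f2_cont : continuous f2.
Hypothesis f2_int : itg vol f2.
Hypothesis f2_hat0 : fourier f2 0 = 1.
Hypothesis f2_hat_ge0 : forall y, 0 <= fourier f2 y.
Hypothesis f3_pd : pd_kernel f3.
Hypothesis h_diag : forall x, r <= enorm x <= Rad ->
  f2 x + f3 x 0 + f3 0 x + f3 x x <= 0.
Hypothesis h_far : forall x, Rad <= enorm x -> f2 x <= 0.
Hypothesis h_off : forall x y, r <= enorm x <= Rad -> r <= enorm y <= Rad ->
  r <= enorm (x - y) -> f3 x y <= 0.

Let M := f2 0 + f3 0 0.

Lemma three_point_value_ge0 : 0 <= M.
Proof.
apply: addr_ge0.
  have := pd_of_cos_transform [:: 0] f2_cont f2_int (fun t => cos_transform_ge0 t f2_hat_ge0).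
  by rewrite !big_seq1 subr0.
have := @pd_kernel_seq R _ f3 [:: 0] f3_pd isT.
by rewrite !big_seq1.
Qed.

(** The lower bound of order [N^2] and the upper bound of order [N] for the same heat pair sum are
    compared, and one factor [N] is cancelled. *)
Lemma separated_count_le (e : R) : 0 < e -> exists2 L, 0 < L &
  forall (rho : R) (C : seq 'rV[R]_n), 0 <= rho -> uniq C -> separated_by r C ->
    {in C, forall x, enorm x <= rho} ->
    (size C)%:R <= ball_vol n (rho + L) * (M + e).
Proof.
move=> e0; have M0 := three_point_value_ge0.
have [K K0 Ksum] := @separated_gauss_sum R n r r0.
pose K1 := (Num.sqrt (pi / 1) ^+ n)^-1 * K : R.
have K10 : 0 <= K1.
  by apply: mulr_ge0; [rewrite invr_ge0 exprn_ge0 ?sqrtr_ge0|exact: ltW].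
(* The final comparison [(1 + eta) M + eta K1 <= (M + e) (1 - 2 eta)] amounts to
   [eta (3 M + K1 + 2 e) <= e]; taking [4 e] in place of [2 e] also gives [4 eta <= 1]. *)
pose den := 3 * M + K1 + 4 * e; have den0 : 0 < den by rewrite /den; lra.
pose eta := e / den; have eta0 : 0 < eta by rewrite divr_gt0.
have etaE : eta * den = e by rewrite divfK// lt0r_neq0.
have eta4 : eta * 4 <= 1.
  by rewrite /eta mulrAC ler_pdivrMr// /den; lra.
have [s s0 Hle] := heat_pair_sum_le f2_cont f2_int (Rintegral_fourier0 f2_hat0)
  (fun t => cos_transform_ge0 t f2_hat_ge0) eta0.
have [L L0 Hge] := @heat_pair_sum_ge R n s eta s0 eta0.
exists L => // rho C rho0 uC Csep Crho.
set N : R := (size C)%:R; set V := ball_vol n (rho + L).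
have V0 : 0 < V by apply: ball_vol_gt0; rewrite ltr_wpDl.
have N0 : 0 <= N by [].
have [->|Nn0] := eqVneq N 0.
  by apply: mulr_ge0; [exact: ltW|apply: addr_ge0 => //; exact: ltW].
have Np : 0 < N by rewrite lt_neqAle eq_sym Nn0.
have A1 := Hge rho C rho0 Crho; have A2 := Hle C.
have A3 := pair_sum_le f3_pd h_diag h_far h_off uC Csep r0.
have A4 : \sum_(x <- C) \sum_(y <- C) heat 1 (x - y) <= N * K1.
  rewrite /N -sum1_size natr_sum mulr_suml; apply: ler_sum => x _.
  rewrite mul1r /heat -mulr_sumr; apply: ler_wpM2l; last exact: Ksum.
  by rewrite invr_ge0 exprn_ge0// sqrtr_ge0.
have A5 : N ^+ 2 * (1 - eta *+ 2) <= V * (N * ((1 + eta) * M + eta * K1)).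
  apply: le_trans A1 _; rewrite ler_pM2l//; apply: le_trans A2 _.
  rewrite [leRHS]mulrDr (mulrCA N (1 + eta)) (mulrCA N eta).
  by apply: lerD; apply: ler_wpM2l => //; lra.
have A6 : N * (1 - eta *+ 2) <= V * ((1 + eta) * M + eta * K1).
  by rewrite -(ler_pM2l Np) mulrA -expr2 mulrCA.
have B0 : 0 < 1 - eta *+ 2 by lra.
rewrite -(ler_pM2r B0); apply: le_trans A6 _; rewrite -[leRHS]mulrA ler_pM2l//.
move: etaE; rewrite /den; nra.
Qed.

End packing_count.

Section packing_geometry.
Context (R : realType) (n : nat).
Notation vol := (lebesgue_rV R n).
Implicit Types (C : set 'rV[R]_n) (s rho : R).

Lemma eball_interior (c x : 'rV[R]_n) s : enorm (x - c) < s -> (eball c s)° x.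
Proof.
move=> xs; have s0 : 0 <= s by rewrite ltW// (le_lt_trans _ xs)// enorm_ge0.
have cB : continuous (fun y : 'rV[R]_n => y - c).
  move=> y; apply: cvgB; [exact: (@nbhs_filter _ y)|exact: cvg_id|].
  exact: (@cvg_cst _ c _ (nbhs y) (@nbhs_filter _ y)).
have cf : {for x, continuous (fun y : 'rV[R]_n => edot (y - c) (y - c))}.
  exact: (continuous_comp (cB x) (@continuous_edot_diag R n (x - c))).
have : edot (x - c) (x - c) < s ^+ 2.
  by rewrite -sqr_enorm ltrXn2r ?nnegrE ?enorm_ge0.
move=> /(cvgr_lt _ cf) near_lt; apply: filterS near_lt => y ys.
rewrite /eball/= -(ler_pXn2r (n := 2)) ?nnegrE ?enorm_ge0//.
by rewrite sqr_enorm ltW.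
Qed.

(** If two centres were closer, their midpoint would lie in both open balls. *)
Lemma packing_separated C s x y : is_packing C s -> C x -> C y -> x != y ->
  s *+ 2 <= enorm (x - y).
Proof.
move=> [s0 tC] Cx Cy xy; rewrite leNgt; apply/negP => xys.
move/eqP: xy; apply; apply: (tC x y) => //.
have h0 : 0 <= 2^-1 :> R by rewrite invr_ge0.
have half z : enorm z < s *+ 2 -> enorm (2^-1 *: z) < s.
  by rewrite enormZ// mulrC ltr_pdivrMr// mulr_natr.
exists (2^-1 *: (x + y)); split; apply: eball_interior.
  rewrite (_ : _ - x = 2^-1 *: (y - x)); first by apply: half; rewrite enormB.
  by apply/rowP => i; rewrite !mxE; field.
rewrite (_ : _ - y = 2^-1 *: (x - y)); first exact: half.
by apply/rowP => i; rewrite !mxE; field.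
Qed.

Lemma measure_bigU_eball_le (X : seq 'rV[R]_n) s :
  (vol (\big[setU/set0]_(c <- X) eball c s) <= ((size X)%:R * ball_vol n s)%:E)%E.
Proof.
elim: X => [|c X ih]; first by rewrite big_nil measure0 mul0r.
have mU : measurable (\big[setU/set0]_(c <- X) eball c s).
  by apply: bigsetU_measurable => i _; exact: measurable_eball.
rewrite big_cons; apply: le_trans (measureU2 _ (measurable_eball _ _) mU) _.
by rewrite /= -natr1 mulrDl mul1r (addrC (_ * _)) EFinD (ball_volE c) leeD2l.
Qed.

(** Only balls with centre within [rho + s] of the origin meet [eball 0 rho]. The bound [b] makes
    these centres finite in number, and subadditivity of the volume applies. *)
Lemma packing_cover_le C s rho (b : R) : 0 < s ->
  (forall X : seq 'rV[R]_n, uniq X -> {in X, forall x, C x /\ enorm x <= rho + s} ->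
    (size X)%:R <= b) ->
  (vol (packing_cover C s `&` eball 0 rho) <= (b * ball_vol n s)%:E)%E.
Proof.
move=> s0 hb; pose D := [set x | C x /\ enorm x <= rho + s].
have finD : finite_set D.
  apply: contrapT => infD.
  have [B BD Bn] := infinite_set_fset (Num.truncn b).+1 infD.
  have : (#|` B|%:R : R) <= b by apply: hb => [|x xB]; [exact: fset_uniq|exact: BD].
  apply/negP; rewrite -ltNge; apply: lt_le_trans (truncnS_gt b) _.
  by rewrite ler_nat.
have [X0 DX0] := (finite_seqP D).1 finD; pose X := undup X0.
have XD x : x \in X <-> D x by rewrite mem_undup DX0.
have cov : packing_cover C s `&` eball 0 rho `<=` \big[setU/set0]_(c <- X) eball c s.
  move=> y [[c Cc yc] yrho]; rewrite -bigcup_seq; exists c => //=.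
  apply/XD; split => //; move: yc yrho; rewrite /eball/= subr0 => yc yrho.
  rewrite -[c](subrK y) addrC (le_trans (enormD _ _))// lerD//.
  by rewrite enormB.
(* Inside [eball 0 rho] the cover coincides with a finite union of balls. *)
have mcov : measurable (packing_cover C s `&` eball 0 rho).
  have -> : packing_cover C s `&` eball 0 rho =
      \big[setU/set0]_(c <- X) eball c s `&` eball 0 rho.
    apply/seteqP; split => y [yc yrho]; split=> //; first exact: cov.
    by move: yc; rewrite -bigcup_seq => -[c /= /XD[Cc _] yc]; exists c.
  apply: measurableI; last exact: measurable_eball.
  by apply: bigsetU_measurable => i _; exact: measurable_eball.
have mU : measurable (\big[setU/set0]_(c <- X) eball c s).
  by apply: bigsetU_measurable => i _; exact: measurable_eball.
apply: (@le_trans _ _ (vol (\big[setU/set0]_(c <- X) eball c s))).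
  by apply: le_measure; rewrite ?inE.
apply: le_trans (measure_bigU_eball_le X s) _.
rewrite lee_fin ler_pM2r ?ball_vol_gt0//; apply: hb; first exact: undup_uniq.
by move=> x /XD.
Qed.

(** The upper limit is an infimum of suprema over neighbourhoods of infinity; the set where the
    bound holds is such a neighbourhood. *)
Lemma upper_density_le (A : set 'rV[R]_n) (m : R) :
  (\forall rho \near +oo, (vol (A `&` eball 0 rho) / vol (eball 0 rho) <= m%:E)%E) ->
  (upper_density A <= m%:E)%E.
Proof.
move=> h; pose F rho := (vol (A `&` eball 0 rho) / vol (eball 0 rho))%E.
apply: ge_ereal_inf; exists (ereal_sup [set F rho | rho in [set rho | (F rho <= m%:E)%E]]).
  by exists [set rho | (F rho <= m%:E)%E].
by apply: ge_ereal_sup => _ [rho /= hrho <-].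
Qed.

End packing_geometry.

(** * Passage from point counts to the packing density *)

Section density.
Context (R : realType) (n : nat).
Notation vol := (lebesgue_rV R n).

(** Rescaling by [lam] turns the separation [2 s] of the centres into [r], so the count applies; the
    shifts by [s] and [L] disappear as [rho] tends to infinity. *)
Lemma packing_density_le (r M : R) : 0 < r -> 0 <= M ->
  (forall e : R, 0 < e -> exists2 L, 0 < L &
    forall (rho : R) (X : seq 'rV[R]_n), 0 <= rho -> uniq X -> separated_by r X ->
      {in X, forall x, enorm x <= rho} ->
      (size X)%:R <= ball_vol n (rho + L) * (M + e)) ->
  (packing_density R n <= (ball_vol n (r / 2) * M)%:E)%E.
Proof.
move=> r0 M0 count; apply: ge_ereal_sup => _ [C [s [pC ->]]].
have s0 : 0 < s by case: pC.
apply/lee_addgt0Pr => e e0; rewrite -EFinD.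
have v0 : 0 < ball_vol n (r / 2) :> R by rewrite ball_vol_gt0// divr_gt0.
(* This [d] costs [e / 2] in the limit, leaving a strict inequality that holds for all large
   [rho]. *)
pose d := e / 2 / ball_vol n (r / 2).
have d0 : 0 < d by rewrite !divr_gt0.
have [L L0 Lcount] := count d d0.
pose lam := r / (s *+ 2).
have lam0 : 0 < lam by rewrite divr_gt0// mulrn_wgt0.
pose b rho := ball_vol n (lam * (rho + s) + L) * (M + d).
have cov rho : 0 < rho -> (vol (packing_cover C s `&` eball 0 rho) <=
    (b rho * ball_vol n s)%:E)%E.
  move=> rho0; apply: packing_cover_le => // X uX XC.
  rewrite -(size_map (fun x => lam *: x)); apply: Lcount.
  - by rewrite mulr_ge0 ?addr_ge0 ?ltW.
  - rewrite map_inj_uniq//; exact: scalerI (lt0r_neq0 lam0).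
  - move=> _ _ /mapP[x xX ->] /mapP[y yX ->] xy.
    rewrite -scalerBr enormZ ?(ltW lam0)// -ler_pdivrMl//.
    rewrite (_ : lam^-1 * r = s *+ 2); last first.
      by rewrite /lam; field; rewrite !lt0r_neq0.
    apply: (packing_separated pC (XC x xX).1 (XC y yX).1).
    by apply: contra_neq xy => ->.
  - move=> _ /mapP[x xX ->]; rewrite enormZ ?(ltW lam0)// ler_pM2l//.
    exact: (XC x xX).2.
have ball_vol1 x : 0 < x -> ball_vol n x = x ^+ n * ball_vol n 1 :> R.
  by move=> x0; rewrite -ball_vol_scale// mulr1.
pose E := s * (lam * s + L).
(* Since [lam * s = r / 2], the covered proportion at radius [rho] is bounded by this polynomial in
   [t = 1 / rho], which is continuous at 0. *)
pose g (t : R) := ball_vol n 1 * (M + d) * (r / 2 + E * t) ^+ n.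
have bE rho : 0 < rho -> b rho * ball_vol n s / ball_vol n rho = g rho^-1.
  move=> rho0; have P : 0 < lam * (rho + s) + L.
    by rewrite addr_gt0// mulr_gt0// addr_gt0.
  rewrite /b /g (ball_vol1 _ P) (ball_vol1 _ s0) (ball_vol1 _ rho0).
  rewrite (_ : r / 2 + E / rho = (lam * (rho + s) + L) * s / rho); last first.
    by rewrite /E /lam; field; rewrite !lt0r_neq0.
  rewrite !exprMn exprVn; field.
  by rewrite expf_neq0 ?lt0r_neq0// ball_vol_gt0.
have g_cvg : g rho^-1 @[rho --> +oo] --> g 0.
  have h1 : rho^-1 @[rho --> +oo] --> (0 : R).
    by apply/gtr0_cvgV0; [near=> rho|exact: cvg_id].
  have h2 : (r / 2 + E * rho^-1) @[rho --> +oo] --> r / 2 + E * 0.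
    by apply: cvgD; [exact: cvg_cst|apply: cvgM h1; exact: cvg_cst].
  apply: cvgM; first exact: cvg_cst.
  exact: (cvg_comp _ _ h2 (@exprn_continuous R n (r / 2 + E * 0))).
have g0 : g 0 < ball_vol n (r / 2) * M + e.
  rewrite /g mulr0 addr0 mulrC mulrA -ball_vol1 ?divr_gt0// mulrDr ltrD2l.
  by rewrite mulrC divfK ?lt0r_neq0// ltr_pdivrMr// ltr_pMr// ltr1n.
apply: upper_density_le; near=> rho.
have rho0 : 0 < rho by [].
have v1 : 0 < ball_vol n rho by exact: ball_vol_gt0.
rewrite (ball_volE 0) inver gt_eqF// lee_pdivrMr//.
apply: le_trans (cov rho rho0) _; rewrite -EFinM lee_fin -ler_pdivrMr// bE// ltW//.
by near: rho; exact: (cvgr_lt _ g_cvg).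
Unshelve. all: by end_near.
Qed.

End density.

Theorem theorem1p1 (R : realType) (n : nat) (hn : (1 <= n)%N)
  (r Rad : R) (hr : 0 < r) (hrR : r < Rad)
  (f2 : 'rV[R]_n -> R) (f3 : 'rV[R]_n -> 'rV[R]_n -> R)
  (f2_cont : continuous f2)
  (f2_int : (lebesgue_rV R n).-integrable setT (EFin \o f2))
  (f2_hat0 : fourier f2 0 = 1)
  (f2_hat_ge0 : forall y, 0 <= fourier f2 y)
  (f3_pd : pd_kernel f3)
  (h_diag : forall x, r <= enorm x <= Rad ->
    f2 x + f3 x 0 + f3 0 x + f3 x x <= 0)
  (h_far : forall x, Rad <= enorm x -> f2 x <= 0)
  (h_off : forall x y, r <= enorm x <= Rad -> r <= enorm y <= Rad ->
    r <= enorm (x - y) -> f3 x y <= 0) :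
  (packing_density R n <=
    lebesgue_rV R n (eball 0 (r / 2)) * (f2 0 + f3 0 0)%:E)%E.
Proof.
rewrite ball_volE -EFinM; apply: packing_density_le => //.
- exact: three_point_value_ge0.
- exact: (separated_count_le hr f2_cont f2_int f2_hat0 f2_hat_ge0 f3_pd h_diag h_far h_off).
Qed.
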